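(* Let $\Lambda$ be a row-finite $k$-graph with no sources and let $K$ be a field. (1) Let $J$ be the (two-sided) ideal of $\mathrm{KP}_K(\Lambda)$ generated by $\{p_v: v\in P_l(\Lambda)\}$. Then $\mathrm{Soc}(\mathrm{KP}_K(\Lambda))=J=I_{\overline{P_l(\Lambda)}}$. (2) $\mathrm{Soc}(\mathrm{KP}_K(\Lambda))$ is an essential ideal of $\mathrm{KP}_K(\Lambda)$ if and only if every vertex connects to a line point (that is, for every $w\in\Lambda^0$ there is a path $\lambda\in\Lambda$ with $r(\lambda)=w$ and $s(\lambda)\in P_l(\Lambda)$).
   Context: $\mathbb N=\{0,1,2,\dots\}$; $k$ is a positive integer; $\mathbb N^k$ is ordered coordinatewise. A $k$-graph is a countable category $\Lambda$ with object set $\Lambda^0$ and range and source maps $r,s$, with a functor $d:\Lambda\to\mathbb N^k$ ($\mathbb N^k$ viewed as a one-object category) such that whenever $d(\lambda)=m+n$ there are unique $\mu,\nu\in\Lambda$ with $s(\mu)=r(\nu)$, $d(\mu)=m$, $d(\nu)=n$, $\lambda=\mu\nu$. Morphisms are called paths; objects (vertices) are identified with the paths of degree $0$. $\Lambda^n=d^{-1}(n)$, $\Lambda^{\neq 0}=\Lambda\setminus\Lambda^0$, $v\Lambda=\{\lambda: r(\lambda)=v\}$, $v\Lambda^n=v\Lambda\cap\Lambda^n$. $\Lambda$ is row-finite with no sources if $0<|v\Lambda^n|<\infty$ for all $v\in\Lambda^0$, $n\in\mathbb N^k$. Infinite paths: $\Omega_k$ is the $k$-graph with objects $\mathbb N^k$,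 morphisms $(m,n)$ with $m\le n$, $r(m,n)=m$, $s(m,n)=n$, $(m,n)(n,p)=(m,p)$, $d(m,n)=n-m$. $\Lambda^\infty$ is the set of degree-preserving functors $x:\Omega_k\to\Lambda$; $x(m):=x(m,m)$; $v\Lambda^\infty=\{x\in\Lambda^\infty:x(0)=v\}$. For $p\in\mathbb N^k$, $\sigma^p(x)(m,n)=x(m+p,n+p)$. $x$ is periodic if $\sigma^p(x)=\sigma^q(x)$ for some $p\ne q$ in $\mathbb N^k$, and aperiodic otherwise. A vertex $v$ is a line point if $v\Lambda^\infty=\{x\}$ is a singleton and $x$ is aperiodic; $P_l(\Lambda)$ is the set of line points. Kumjian-Pask algebra: $\mathrm{KP}_K(\Lambda)$ is the universal $K$-algebra generated by elements $p_v$ ($v\in\Lambda^0$), $s_\lambda$, $s_{\lambda^*}$ ($\lambda\in\Lambda^{\ne0}$) subject to: (KP1) the $p_v$ are mutually orthogonal idempotents; (KP2) for $\lambda,\mu\in\Lambda^{\neq0}$ with $r(\mu)=s(\lambda)$: $s_\lambda s_\mu=s_{\lambda\mu}$, $s_{\mu^*}s_{\lambda^*}=s_{(\lambda\mu)^*}$, $p_{r(\lambda)}s_\lambda=s_\lambda=s_\lambda p_{s(\lambda)}$, $p_{s(\lambda)}s_{\lambda^*}=s_{\lambda^*}=s_{\lambda^*}p_{r(\lambda)}$; (KP3) $s_{\lambda^*}s_\mu=\delta_{\lambda,\mu}p_{s(\lambda)}$ if $d(\lambda)=d(\mu)$; (KP4) $p_v=\sum_{\lambda\in v\Lambda^n}s_\lambda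 s_{\lambda^*}$ for all $v\in\Lambda^0$, $n\in\mathbb N^k\setminus\{0\}$. (The algebra need not be unital.) $H\subset\Lambda^0$ is hereditary if $r(\lambda)\in H$ implies $s(\lambda)\in H$ for $\lambda\in\Lambda$; it is saturated if $v\in\Lambda^0$, $n\in\mathbb N^k$ and $s(v\Lambda^n)\subset H$ imply $v\in H$. $\overline W$ denotes the smallest saturated hereditary subset containing $W\subset\Lambda^0$. For $H$ saturated hereditary, $I_H$ is the ideal of $\mathrm{KP}_K(\Lambda)$ generated by $\{p_v:v\in H\}$. The socle $\mathrm{Soc}(A)$ of a semiprime algebra $A$ is the sum of all its minimal left-ideals ($\{0\}$ if there are none); it is a two-sided ideal and equals the sum of the minimal right-ideals. $\mathrm{KP}_K(\Lambda)$ is semiprime. An ideal $I$ of an algebra $A$ is essential if $a\in A$ and $aI=\{0\}$ imply $a=0$. *)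

(* Defs.v *)
From HB Require Import structures.
From mathcomp Require Import all_boot all_algebra.
From mathcomp Require Import boolp classical_sets functions cardinality fsbigop.

Set Implicit Arguments.
Unset Strict Implicit.
Unset Printing Implicit Defensive.

Import GRing.Theory.
Local Open Scope classical_set_scope.
Local Open Scope ring_scope.
Local Open Scope quotient_scope.
#[local] Obligation Tactic := idtac.

(* Degrees: elements of N^k, with the library's pointwise addition. *)
Notation degree k := {ffun 'I_k -> nat}.

Definition dle k (m n : degree k) : bool := [forall i, (m i <= n i)%N].

Definition dsub k (n m : degree k) : degree k := [ffun i => (n i - m i)%N].

(* Composition is totalised: [kcomp l m] stands for the composite only when
   [ksrc l = krng m], and its value is unconstrained otherwise. *)
Record kgraph (k : nat) := KGraph {
  kvertex : countType;
  kpath : countType;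
  krng : kpath -> kvertex;
  ksrc : kpath -> kvertex;
  kid : kvertex -> kpath;
  kcomp : kpath -> kpath -> kpath;
  kdeg : kpath -> degree k;
  krng_id : forall v, krng (kid v) = v;
  ksrc_id : forall v, ksrc (kid v) = v;
  krng_comp : forall l m, ksrc l = krng m -> krng (kcomp l m) = krng l;
  ksrc_comp : forall l m, ksrc l = krng m -> ksrc (kcomp l m) = ksrc m;
  kcomp_idl : forall l, kcomp (kid (krng l)) l = l;
  kcomp_idr : forall l, kcomp l (kid (ksrc l)) = l;
  kcompA : forall l m n, ksrc l = krng m -> ksrc m = krng n ->
    kcomp l (kcomp m n) = kcomp (kcomp l m) n;
  kdeg_id : forall v, kdeg (kid v) = 0;
  kdeg_comp : forall l m, ksrc l = krng m ->
    kdeg (kcomp l m) = kdeg l + kdeg m;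
  kfact : forall l m n, kdeg l = m + n ->
    exists! p : kpath * kpath,
      [/\ ksrc p.1 = krng p.2, kdeg p.1 = m, kdeg p.2 = n & l = kcomp p.1 p.2]
}.

Arguments kid {k} L v : rename.

Definition paths_from k (L : kgraph k) (v : kvertex L) (n : degree k) :
  set (kpath L) := [set l | krng l = v /\ kdeg l = n].

Definition row_finite_no_sources k (L : kgraph k) : Prop :=
  forall (v : kvertex L) (n : degree k),
    finite_set (paths_from v n) /\ paths_from v n !=set0.

(* Degree-preserving functors. *)
Record kmorphism k (L M : kgraph k) := KMorphism {
  kmor_ob : kvertex L -> kvertex M;
  kmor :> kpath L -> kpath M;
  kmor_rng : forall l, krng (kmor l) = kmor_ob (krng l);
  kmor_src : forall l, ksrc (kmor l) = kmor_ob (ksrc l);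
  kmor_id : forall v, kmor (kid L v) = kid M (kmor_ob v);
  kmor_comp : forall l m, ksrc l = krng m ->
    kmor (kcomp l m) = kcomp (kmor l) (kmor m);
  kmor_deg : forall l, kdeg (kmor l) = kdeg l
}.

Lemma kmorphism_eq k (L M : kgraph k) (f g : kmorphism L M) :
  (forall l, f l = g l) -> f = g.
Proof.
move=> fg; have fgo : kmor_ob f = kmor_ob g.
  by apply/funext => v; rewrite -[LHS](krng_id) -kmor_id fg kmor_id krng_id.
have fgm : kmor f = kmor g by apply/funext.
case: f g fg fgo fgm => fo fm a1 a2 a3 a4 a5 [go gm b1 b2 b3 b4 b5] _ /= eo em.
by subst; f_equal; exact: Prop_irrelevance.
Qed.

Program Definition kmor_compose k (L M N : kgraph k)
    (g : kmorphism M N) (f : kmorphism L M) : kmorphism L N :=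
  @KMorphism k L N (kmor_ob g \o kmor_ob f) (kmor g \o kmor f) _ _ _ _ _.
Next Obligation. by move=> k L M N g f l /=; rewrite !kmor_rng. Qed.
Next Obligation. by move=> k L M N g f l /=; rewrite !kmor_src. Qed.
Next Obligation. by move=> k L M N g f l /=; rewrite !kmor_id. Qed.
Next Obligation.
by move=> k L M N g f l m lm /=; rewrite !kmor_comp // kmor_src kmor_rng lm.
Qed.
Next Obligation. by move=> k L M N g f l /=; rewrite !kmor_deg. Qed.

Definition omega_path k := {p : degree k * degree k | dle p.1 p.2}.

HB.instance Definition _ k := SubCountable.on (omega_path k).

Lemma dle_refl k (m : degree k) : dle m m.
Proof. exact/forallP. Qed.

Lemma dle_trans k (m n p : degree k) : dle n m -> dle m p -> dle n p.
Proof.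
by move=> /forallP nm /forallP mp; apply/forallP => i; apply: leq_trans (mp i).
Qed.

Lemma dle_addr k (m n : degree k) : dle m (m + n).
Proof. by apply/forallP => i; rewrite ffunE leq_addr. Qed.

Lemma dle_add2r k (p m n : degree k) : dle (m + p) (n + p) = dle m n.
Proof. by apply: eq_forallb => i; rewrite !ffunE leq_add2r. Qed.

Lemma dsubKC k (m n : degree k) : dle m n -> m + dsub n m = n.
Proof.
by move=> /forallP mn; apply/ffunP => i; rewrite !ffunE; exact: subnKC.
Qed.

Lemma daddKl k (m n : degree k) : dsub (m + n) m = n.
Proof. by apply/ffunP => i; rewrite !ffunE; exact: addKn. Qed.

Lemma daddIl k (p m n : degree k) : p + m = p + n -> m = n.
Proof. by move=> e; rewrite -(daddKl p m) e daddKl. Qed.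

Section Omega.
Variable k : nat.
Implicit Types (a b c : omega_path k) (m n p : degree k).

Definition omega_rng a : degree k := (val a).1.
Definition omega_src a : degree k := (val a).2.
Definition omega_mk m n (mn : dle m n) : omega_path k := exist _ (m, n) mn.
Definition omega_id m : omega_path k := omega_mk (dle_refl m).
Definition omega_deg a : degree k := dsub (omega_src a) (omega_rng a).

(* The default value of [insubd] is only reached when (m, n), (n', p) are not
   composable; composable pairs give (m, p). *)
Definition omega_comp a b : omega_path k :=
  insubd a (omega_rng a, omega_src b).

Lemma omega_le a : dle (omega_rng a) (omega_src a).
Proof. exact: valP a. Qed.

Lemma omega_eq a b :
  omega_rng a = omega_rng b -> omega_src a = omega_src b -> a = b.
Proof.
case: a b => [[a1 a2] ha] [[b1 b2] hb]; rewrite /omega_rng /omega_src /=.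
by move=> e1 e2; apply: val_inj => /=; rewrite e1 e2.
Qed.

Lemma omega_compE a b : omega_src a = omega_rng b ->
  val (omega_comp a b) = (omega_rng a, omega_src b).
Proof.
move=> ab; rewrite /omega_comp insubdK // unfold_in /=.
by apply: dle_trans (omega_le a) _; rewrite ab; exact: omega_le.
Qed.

Lemma omega_rng_comp a b : omega_src a = omega_rng b ->
  omega_rng (omega_comp a b) = omega_rng a.
Proof. by move=> ab; rewrite {1}/omega_rng omega_compE. Qed.

Lemma omega_src_comp a b : omega_src a = omega_rng b ->
  omega_src (omega_comp a b) = omega_src b.
Proof. by move=> ab; rewrite {1}/omega_src omega_compE. Qed.

Lemma omega_comp_idl a : omega_comp (omega_id (omega_rng a)) a = a.
Proof. by apply: omega_eq; rewrite ?omega_rng_comp ?omega_src_comp. Qed.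

Lemma omega_comp_idr a : omega_comp a (omega_id (omega_src a)) = a.
Proof. by apply: omega_eq; rewrite ?omega_rng_comp ?omega_src_comp. Qed.

Lemma omega_compA a b c :
  omega_src a = omega_rng b -> omega_src b = omega_rng c ->
  omega_comp a (omega_comp b c) = omega_comp (omega_comp a b) c.
Proof.
by move=> ab bc; apply: omega_eq;
  rewrite ?(omega_rng_comp, omega_src_comp) ?(omega_rng_comp, omega_src_comp).
Qed.

Lemma omega_deg_id m : omega_deg (omega_id m) = 0.
Proof. by apply/ffunP => i; rewrite !ffunE subnn. Qed.

Lemma omega_degK a : omega_rng a + omega_deg a = omega_src a.
Proof. exact: dsubKC (omega_le a). Qed.

Lemma omega_deg_comp a b : omega_src a = omega_rng b ->
  omega_deg (omega_comp a b) = omega_deg a + omega_deg b.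
Proof.
move=> ab; apply: (@daddIl _ (omega_rng (omega_comp a b))).
rewrite omega_degK omega_rng_comp // omega_src_comp // addrA omega_degK ab.
by rewrite omega_degK.
Qed.

Lemma omega_fact a m n : omega_deg a = m + n ->
  exists! p : omega_path k * omega_path k,
    [/\ omega_src p.1 = omega_rng p.2, omega_deg p.1 = m, omega_deg p.2 = n
      & a = omega_comp p.1 p.2].
Proof.
move=> e.
have h : dle (omega_rng a + m) (omega_src a).
  by rewrite -omega_degK e addrA dle_addr.
exists (omega_mk (dle_addr (omega_rng a) m), omega_mk h).
split=> [|[b c] /= [bc bm cn abc]].
  split=> //=; first exact: daddKl.
    by rewrite /omega_deg /= /omega_src /omega_rng /= -/(omega_src a)
      -/(omega_rng a) -omega_degK e addrA daddKl.
  by apply: omega_eq; rewrite ?omega_rng_comp ?omega_src_comp.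
have ra : omega_rng a = omega_rng b by rewrite abc omega_rng_comp.
have sa : omega_src a = omega_src c by rewrite abc omega_src_comp.
by congr pair; apply: omega_eq => //=;
  rewrite -?bc -(omega_degK b) bm /omega_src /omega_rng /= -/(omega_rng a) ra.
Qed.

Definition Omega : kgraph k := @KGraph k (degree k) (omega_path k)
  omega_rng omega_src omega_id omega_comp omega_deg
  (fun=> erefl) (fun=> erefl) omega_rng_comp omega_src_comp
  omega_comp_idl omega_comp_idr omega_compA omega_deg_id omega_deg_comp
  omega_fact.

Lemma omega_shift_le p a : dle (omega_rng a + p) (omega_src a + p).
Proof. by rewrite dle_add2r omega_le. Qed.

Definition omega_shift_path p a : omega_path k := omega_mk (omega_shift_le p a).

Lemma omega_shift_id p m :
  omega_shift_path p (omega_id m) = omega_id (m + p).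
Proof. exact: omega_eq. Qed.

Lemma omega_shift_comp p a b : omega_src a = omega_rng b ->
  omega_shift_path p (omega_comp a b) =
  omega_comp (omega_shift_path p a) (omega_shift_path p b).
Proof.
move=> ab.
have e : omega_src (omega_shift_path p a) = omega_rng (omega_shift_path p b).
  by rewrite /omega_src /omega_rng /= ab.
apply: omega_eq.
  by rewrite omega_rng_comp // /omega_rng /= -/(omega_rng _) omega_rng_comp.
by rewrite omega_src_comp // /omega_src /= -/(omega_src _) omega_src_comp.
Qed.

Lemma omega_shift_deg p a : omega_deg (omega_shift_path p a) = omega_deg a.
Proof.
apply: (@daddIl _ (omega_rng (omega_shift_path p a))); rewrite omega_degK.
change (omega_src a + p = omega_rng a + p + omega_deg a).
by rewrite addrAC omega_degK.
Qed.

(* (m, n) |-> (m + p, n + p) *)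
Definition omega_shift p : kmorphism Omega Omega :=
  @KMorphism k Omega Omega (fun m => m + p) (omega_shift_path p)
    (fun=> erefl) (fun=> erefl) (omega_shift_id p) (@omega_shift_comp p)
    (omega_shift_deg p).

End Omega.

Section InfinitePaths.
Variables (k : nat) (L : kgraph k).

Definition infinite_path := kmorphism (Omega k) L.

(* The vertex x(m), i.e. the object part of the functor x. *)
Definition path_vertex (x : infinite_path) (m : degree k) : kvertex L :=
  kmor_ob x m.

Definition shift (p : degree k) (x : infinite_path) : infinite_path :=
  kmor_compose x (omega_shift p).

Definition periodic (x : infinite_path) : Prop :=
  exists p q : degree k, p <> q /\ shift p x = shift q x.

Definition aperiodic (x : infinite_path) : Prop := ~ periodic x.

Definition infinite_paths_from (v : kvertex L) : set infinite_path :=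
  [set x | path_vertex x 0 = v].

Definition line_points : set (kvertex L) :=
  [set v | exists x, infinite_paths_from v = [set x] /\ aperiodic x].

Definition hereditary (H : set (kvertex L)) : Prop :=
  forall l : kpath L, H (krng l) -> H (ksrc l).

Definition saturated (H : set (kvertex L)) : Prop :=
  forall (v : kvertex L) (n : degree k),
    (@ksrc k L) @` (paths_from v n) `<=` H -> H v.

Definition saturated_hereditary (H : set (kvertex L)) : Prop :=
  saturated H /\ hereditary H.

Definition sat_her_closure (W : set (kvertex L)) : set (kvertex L) :=
  smallest saturated_hereditary W.

End InfinitePaths.

Arguments line_points {k} L _.

HB.mixin Record Lmodule_isNonUnitalAlgebra (K : fieldType) A
    of GRing.Lmodule K A := {
  amul : A -> A -> A;
  amulA : forall x y z, amul x (amul y z) = amul (amul x y) z;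
  amulDl : forall x y z, amul (x + y) z = amul x z + amul y z;
  amulDr : forall x y z, amul x (y + z) = amul x y + amul x z;
  amulZl : forall (c : K) x y, amul (c *: x) y = c *: amul x y;
  amulZr : forall (c : K) x y, amul x (c *: y) = c *: amul x y
}.

#[short(type="nuAlgType")]
HB.structure Definition NonUnitalAlgebra (K : fieldType) :=
  {A of Lmodule_isNonUnitalAlgebra K A & GRing.Lmodule K A}.

Section Ideals.
Variables (K : fieldType) (A : nuAlgType K).
Implicit Types I : set A.

Definition subspace I : Prop :=
  [/\ I 0, forall x y, I x -> I y -> I (x + y)
    & forall (c : K) x, I x -> I (c *: x)].

Definition left_ideal I : Prop :=
  subspace I /\ forall a x : A, I x -> I (amul a x).

Definition two_sided_ideal I : Prop :=
  left_ideal I /\ forall a x : A, I x -> I (amul x a).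

Definition ideal_gen (X : set A) : set A := smallest two_sided_ideal X.

Definition minimal_left_ideal I : Prop :=
  [/\ left_ideal I, I <> [set 0]
    & forall I', left_ideal I' -> I' `<=` I -> I' = [set 0] \/ I' = I].

Definition socle : set A :=
  [set a | exists s : seq A,
    (forall x, x \in s -> exists I, minimal_left_ideal I /\ I x) /\
    a = \sum_(x <- s) x].

Definition essential_ideal I : Prop :=
  two_sided_ideal I /\ forall a : A, amul a @` I = [set 0] -> a = 0.

End Ideals.

Arguments socle {K} A _.

Definition npath k (L : kgraph k) := {l : kpath L | kdeg l != 0}.

HB.instance Definition _ k (L : kgraph k) := SubCountable.on (npath L).

(* (KP1)-(KP4); [fam_t l] is the generator attached to the ghost path of l. The
   sum in [fam_KP4] is over a finite set as soon as L is row-finite. *)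
Record kp_family (K : fieldType) k (L : kgraph k) (B : nuAlgType K) := KPFamily {
  fam_p : kvertex L -> B;
  fam_s : npath L -> B;
  fam_t : npath L -> B;
  fam_KP1 : forall v w, amul (fam_p v) (fam_p w) = if v == w then fam_p v else 0;
  fam_KP2s : forall l m lm : npath L, ksrc (val l) = krng (val m) ->
    val lm = kcomp (val l) (val m) -> amul (fam_s l) (fam_s m) = fam_s lm;
  fam_KP2t : forall l m lm : npath L, ksrc (val l) = krng (val m) ->
    val lm = kcomp (val l) (val m) -> amul (fam_t m) (fam_t l) = fam_t lm;
  fam_KP2ps : forall l, amul (fam_p (krng (val l))) (fam_s l) = fam_s l;
  fam_KP2sp : forall l, amul (fam_s l) (fam_p (ksrc (val l))) = fam_s l;
  fam_KP2pt : forall l, amul (fam_p (ksrc (val l))) (fam_t l) = fam_t l;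
  fam_KP2tp : forall l, amul (fam_t l) (fam_p (krng (val l))) = fam_t l;
  fam_KP3 : forall l m, kdeg (val l) = kdeg (val m) ->
    amul (fam_t l) (fam_s m) = if l == m then fam_p (ksrc (val l)) else 0;
  fam_KP4 : forall (v : kvertex L) (n : degree k), n != 0 ->
    fam_p v = \sum_(l \in [set l : npath L | paths_from v n (val l)])
                amul (fam_s l) (fam_t l)
}.

(* KP_K(L) is the set of formal algebra expressions in the generators, two
   expressions being identified when they take the same value on every family
   satisfying (KP1)-(KP4) in every K-algebra. [kp_lift] and [kp_lift_unique]
   below give its universal property. *)
Section KumjianPask.
Variables (K : fieldType) (k : nat) (L : kgraph k).

Inductive kp_term :=
  | TP of kvertex L
  | TS of npath L
  | TT of npath L
  | TZero
  | TAdd of kp_term & kp_term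
  | TScale of K & kp_term
  | TMul of kp_term & kp_term.

HB.instance Definition _ := gen_eqMixin kp_term.
HB.instance Definition _ := gen_choiceMixin kp_term.

Fixpoint kp_eval (B : nuAlgType K) (f : kp_family L B) (t : kp_term) : B :=
  match t with
  | TP v => fam_p f v
  | TS l => fam_s f l
  | TT l => fam_t f l
  | TZero => 0
  | TAdd t u => kp_eval f t + kp_eval f u
  | TScale c t => c *: kp_eval f t
  | TMul t u => amul (kp_eval f t) (kp_eval f u)
  end.

Definition kp_eqv (t u : kp_term) : Prop :=
  forall (B : nuAlgType K) (f : kp_family L B), kp_eval f t = kp_eval f u.

Definition kp_eqvb (t u : kp_term) : bool := `[< kp_eqv t u >].

Lemma kp_eqvb_equiv : equiv_class_of kp_eqvb.
Proof.
split=> [t|t u|u t w].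
- by apply/asboolP.
- by apply/asboolP/asboolP => h B f; rewrite h.
- by move=> /asboolP h1 /asboolP h2; apply/asboolP => B f; rewrite h1.
Qed.

Canonical kp_equiv_rel := EquivRelPack kp_eqvb_equiv.

Definition KP := {eq_quot kp_eqvb}.

HB.instance Definition _ := Choice.on KP.
HB.instance Definition _ := EqQuotient.on KP.

Definition kp_class (t : kp_term) : KP := \pi_KP t.

Lemma kp_classP t u : kp_class t = kp_class u <-> kp_eqv t u.
Proof. by split=> [/eqmodP/asboolP|h] //; apply/eqmodP/asboolP. Qed.

Lemma kp_reprE B (f : kp_family L B) t :
  kp_eval f (repr (kp_class t)) = kp_eval f t.
Proof. by move: B f; apply/kp_classP; rewrite /kp_class reprK. Qed.

Lemma kp_reprK (x : KP) : kp_class (repr x) = x.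
Proof. exact: reprK. Qed.

Definition kp_zero : KP := kp_class TZero.
Definition kp_add (x y : KP) : KP := kp_class (TAdd (repr x) (repr y)).
Definition kp_scale (c : K) (x : KP) : KP := kp_class (TScale c (repr x)).
Definition kp_opp (x : KP) : KP := kp_scale (-1) x.
Definition kp_mul (x y : KP) : KP := kp_class (TMul (repr x) (repr y)).

Lemma kp_ext (x y : KP) :
  (forall B (f : kp_family L B), kp_eval f (repr x) = kp_eval f (repr y)) ->
  x = y.
Proof. by move=> h; rewrite -[x]kp_reprK -[y]kp_reprK; apply/kp_classP. Qed.

Fact kp_addA : associative kp_add.
Proof. by move=> x y z; apply: kp_ext => B f; rewrite !(kp_reprE, addrA) /= !kp_reprE /= addrA. Qed.
Fact kp_addC : commutative kp_add.
Proof. by move=> x y; apply: kp_ext => B f; rewrite !kp_reprE /= addrC. Qed.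
Fact kp_add0 : left_id kp_zero kp_add.
Proof. by move=> x; apply: kp_ext => B f; rewrite !kp_reprE /= kp_reprE add0r. Qed.
Fact kp_addN : left_inverse kp_zero kp_opp kp_add.
Proof.
by move=> x; apply: kp_ext => B f; rewrite !kp_reprE /= kp_reprE /= scaleN1r addNr.
Qed.

HB.instance Definition _ :=
  GRing.isZmodule.Build KP kp_addA kp_addC kp_add0 kp_addN.

Fact kp_scaleA c d x : kp_scale c (kp_scale d x) = kp_scale (c * d) x.
Proof. by apply: kp_ext => B f; rewrite !kp_reprE /= kp_reprE /= scalerA. Qed.
Fact kp_scale1 : left_id 1 kp_scale.
Proof. by move=> x; apply: kp_ext => B f; rewrite !kp_reprE /= scale1r. Qed.
Fact kp_scaleDr : right_distributive kp_scale +%R.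
Proof.
by move=> c x y; apply: kp_ext => B f; rewrite !kp_reprE /= !kp_reprE /= scalerDr.
Qed.
Fact kp_scaleDl x : {morph kp_scale^~ x : c d / c + d}.
Proof.
by move=> c d; apply: kp_ext => B f; rewrite !kp_reprE /= !kp_reprE /= scalerDl.
Qed.

HB.instance Definition _ := GRing.Zmodule_isLmodule.Build K KP
  kp_scaleA kp_scale1 kp_scaleDr kp_scaleDl.

Fact kp_mulA x y z : kp_mul x (kp_mul y z) = kp_mul (kp_mul x y) z.
Proof. by apply: kp_ext => B f; rewrite !kp_reprE /= !kp_reprE /= amulA. Qed.
Fact kp_mulDl x y z : kp_mul (x + y) z = kp_mul x z + kp_mul y z.
Proof. by apply: kp_ext => B f; rewrite !kp_reprE /= !kp_reprE /= amulDl. Qed.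
Fact kp_mulDr x y z : kp_mul x (y + z) = kp_mul x y + kp_mul x z.
Proof. by apply: kp_ext => B f; rewrite !kp_reprE /= !kp_reprE /= amulDr. Qed.
Fact kp_mulZl (c : K) x y : kp_mul (c *: x) y = c *: kp_mul x y.
Proof. by apply: kp_ext => B f; rewrite !kp_reprE /= !kp_reprE /= amulZl. Qed.
Fact kp_mulZr (c : K) x y : kp_mul x (c *: y) = c *: kp_mul x y.
Proof. by apply: kp_ext => B f; rewrite !kp_reprE /= !kp_reprE /= amulZr. Qed.

HB.instance Definition _ := Lmodule_isNonUnitalAlgebra.Build K KP
  kp_mulA kp_mulDl kp_mulDr kp_mulZl kp_mulZr.

Definition kp_p (v : kvertex L) : KP := kp_class (TP v).
Definition kp_s (l : npath L) : KP := kp_class (TS l).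
Definition kp_t (l : npath L) : KP := kp_class (TT l).

Lemma kp_eval0 B (f : kp_family L B) : kp_eval f (repr (0 : KP)) = 0.
Proof. by rewrite kp_reprE. Qed.

Lemma kp_evalD B (f : kp_family L B) (x y : KP) :
  kp_eval f (repr (x + y)) = kp_eval f (repr x) + kp_eval f (repr y).
Proof. by rewrite kp_reprE. Qed.

Lemma kp_evalZ B (f : kp_family L B) (c : K) (x : KP) :
  kp_eval f (repr (c *: x)) = c *: kp_eval f (repr x).
Proof. by rewrite kp_reprE. Qed.

Lemma kp_evalM B (f : kp_family L B) (x y : KP) :
  kp_eval f (repr (amul x y)) = amul (kp_eval f (repr x)) (kp_eval f (repr y)).
Proof. by rewrite kp_reprE. Qed.

Lemma kp_eval_sum B (f : kp_family L B) I (r : seq I) (F : I -> KP) :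
  kp_eval f (repr (\sum_(i <- r) F i)) = \sum_(i <- r) kp_eval f (repr (F i)).
Proof.
exact: (big_morph (fun x : KP => kp_eval f (repr x)) (kp_evalD f) (kp_eval0 f)).
Qed.

Lemma npaths_finite : row_finite_no_sources L ->
  forall v n, finite_set [set l : npath L | paths_from v n (val l)].
Proof.
move=> hL v n; have [fin _] := hL v n.
by apply: finite_preimage fin => x y _ _; exact: val_inj.
Qed.

Lemma kp_KP4 : row_finite_no_sources L ->
  forall (v : kvertex L) (n : degree k), n != 0 ->
  kp_p v = \sum_(l \in [set l : npath L | paths_from v n (val l)])
             amul (kp_s l) (kp_t l).
Proof.
move=> hL v n n0; have fin := npaths_finite hL v n.
apply: kp_ext => B f; rewrite fsbig_finite //= kp_eval_sum kp_reprE /=.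
rewrite (fam_KP4 f v n0) fsbig_finite //=.
by apply: eq_bigr => l _; rewrite kp_evalM !kp_reprE.
Qed.

Definition kp_fam (hL : row_finite_no_sources L) : kp_family L KP.
Proof.
refine (@KPFamily K k L KP kp_p kp_s kp_t _ _ _ _ _ _ _ _ (kp_KP4 hL)).
- move=> v w; apply: kp_ext => B f; rewrite kp_evalM !kp_reprE /= fam_KP1.
  by case: ifP => _; rewrite !kp_reprE.
- by move=> *; apply: kp_ext => B f; rewrite kp_evalM !kp_reprE /=; exact: fam_KP2s.
- by move=> *; apply: kp_ext => B f; rewrite kp_evalM !kp_reprE /=; exact: fam_KP2t.
- by move=> *; apply: kp_ext => B f; rewrite kp_evalM !kp_reprE /=; exact: fam_KP2ps.
- by move=> *; apply: kp_ext => B f; rewrite kp_evalM !kp_reprE /=; exact: fam_KP2sp.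
- by move=> *; apply: kp_ext => B f; rewrite kp_evalM !kp_reprE /=; exact: fam_KP2pt.
- by move=> *; apply: kp_ext => B f; rewrite kp_evalM !kp_reprE /=; exact: fam_KP2tp.
- move=> l m lm; apply: kp_ext => B f; rewrite kp_evalM !kp_reprE /= fam_KP3 //.
  by case: ifP => _; rewrite !kp_reprE.
Defined.

Lemma kp_lift (B : nuAlgType K) (f : kp_family L B) :
  exists h : {linear KP -> B},
    [/\ {morph h : x y / amul x y}, forall v, h (kp_p v) = fam_p f v,
       forall l, h (kp_s l) = fam_s f l & forall l, h (kp_t l) = fam_t f l].
Proof.
pose h (x : KP) := kp_eval f (repr x).
have hlin : linear h by move=> c x y; rewrite /h kp_evalD kp_evalZ.
pose hL := GRing.isLinear.Build K KP B *:%R h hlin.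
pose H : {linear KP -> B} := HB.pack h hL.
exists H; split=> [x y|v|l|l]; [exact: kp_evalM|exact: kp_reprE..].
Qed.

Lemma kp_lift_unique (B : nuAlgType K) (h g : {linear KP -> B}) :
  {morph h : x y / amul x y} -> {morph g : x y / amul x y} ->
  (forall v, h (kp_p v) = g (kp_p v)) -> (forall l, h (kp_s l) = g (kp_s l)) ->
  (forall l, h (kp_t l) = g (kp_t l)) -> h =1 g.
Proof.
move=> hM gM hp hs ht x; rewrite -[x]kp_reprK.
elim: (repr x) => {x} [v|l|l||t IHt u IHu|c t IHt|t IHt u IHu].
- exact: hp.
- exact: hs.
- exact: ht.
- by rewrite -[kp_class TZero]/(0 : KP) !raddf0.
- suff -> : kp_class (TAdd t u) = kp_class t + kp_class u.
    by rewrite !raddfD; congr (_ + _).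
  by apply/kp_classP => B' f /=; rewrite !kp_reprE.
- suff -> : kp_class (TScale c t) = c *: kp_class t by rewrite !linearZ; congr (_ *: _).
  by apply/kp_classP => B' f /=; rewrite !kp_reprE.
- suff -> : kp_class (TMul t u) = amul (kp_class t) (kp_class u).
    by rewrite hM gM IHt IHu.
  by apply/kp_classP => B' f /=; rewrite !kp_reprE.
Qed.

Definition vertex_ideal (H : set (kvertex L)) : set KP :=
  ideal_gen (kp_p @` H).

End KumjianPask.

Arguments kp_p K {k L} v.
Arguments kp_s K {k L} l.
Arguments kp_t K {k L} l.
Arguments vertex_ideal K {k L} H.

(* Main.v *)
From HB Require Import structures.
From mathcomp Require Import all_boot all_algebra.
From mathcomp Require Import boolp classical_sets functions cardinality fsbigop.
Require Import Defs.

Set Implicit Arguments.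
Unset Strict Implicit.
Unset Printing Implicit Defensive.

Import GRing.Theory.
Local Open Scope classical_set_scope.
Local Open Scope ring_scope.

(** Write A for the algebra, S_l and T_l for the generators attached to a path l
and to its ghost, with S_v = T_v = p_v when l is a vertex v, and l y for the
infinite path that starts with l and continues with y.  Let J be the ideal
generated by the p_v with v a line point.

The basic tool is [reduction]: A is spanned by the products S_l T_m, so if a is
a nonzero element, then for some path n the product a S_n is a nonzero
combination of distinct paths with a common source.  A combination of that kind
never vanishes ([comb_neq0]); this is seen in the representation of A on the
functions from infinite paths to K(t), in which S_l prefixes l and multiplies by
t^(weight of the degree of l).  The weight is a linear functional with natural
coefficients, chosen injective on the finitely many degrees at hand, so that a
single variable does the work of the grading by Z^k.

J lies in the socle because A p_v is a minimal left ideal for each line point v: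
distinct paths a, b whose common source is a line point satisfy T_a S_b = 0, so a
nonzero element x of A p_v gives a combination x S_n from which T_a, for a any of
its paths, extracts a nonzero multiple of a vertex projection, and then p_v
itself lies in A x ([line_point_minimal]).

The socle lies in J.  Let M be a minimal left ideal.  Among the combinations of
distinct paths with a common source v found in the translates M z, take one with
as few terms as possible, say the sum of the c_i S_(l_i).  Let y be an infinite
path from v.  Multiplying by S_g T_g on the left, for g an initial segment of
l_1 y, and by a segment of y on the right, keeps the terms whose path l_i y has
the same initial segment; by minimality all terms survive, hence all the infinite
paths l_i y are equal.  If there were two terms, the element a = T_(l_1) sum c_i
S_(l_i) would multiply the function concentrated at y by a scalar c that, up to a
power of t, is a polynomial with at least two terms.  Minimality of M gives
a = x a a for some x, so that 1/c is a value of x applied to that function.  Such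
values are Laurent polynomials, and a Laurent polynomial with two terms is not
invertible ([minimal_comb_size]).  So there is one term, and some translate M z
contains p_v.  Here v is a line point: if l, m are distinct paths of the same
degree from v, then p_v would be a left multiple of S_l T_l, which S_m annihilates;
if they have the same source instead, the two-term combination S_l + S_m lies in
a translate of M and l y = m y for all y, which has just been excluded.  Writing
p_v = b z with b in M, the element p_v b is nonzero and belongs to both M and J,
so M is contained in J.

The vertices v with p_v in J form a saturated hereditary set, which gives the
equality with the ideal of the closure.  If every vertex connects to a line point
and a J = 0, a nonzero a would give a nonzero combination a S_n, then a nonzero
a S_n S_m with m ending at a line point, although S_n S_m is in J.  Conversely, if
w does not connect to a line point, then p_w A p_v = 0 for all line points v,
hence p_w J = 0 with p_w nonzero. *)

(** * Unique factorisation of paths *)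

Section Factorisation.
Variables (k : nat) (L : kgraph k).
Implicit Types (l m : kpath L) (n p q : degree k).

Lemma dle_add0 n : dle 0 n.
Proof. by rewrite -[n]add0r dle_addr. Qed.

Lemma dle_addP (m n : degree k) : reflect (exists p, n = m + p) (dle m n).
Proof.
by apply: (iffP idP) => [/dsubKC <-|[p ->]]; [exists (dsub n m)|exact: dle_addr].
Qed.

Lemma kcomp_inj l m l' m' :
  ksrc l = krng m -> ksrc l' = krng m' -> kdeg l = kdeg l' ->
  kcomp l m = kcomp l' m' -> l = l' /\ m = m'.
Proof.
move=> lm lm' dl e.
have dm : kdeg m = kdeg m'.
  by apply: (@daddIl _ (kdeg l)); rewrite {2}dl -!kdeg_comp // e.
have [p [_ up]] := kfact (kdeg_comp lm).
have e1 : p = (l, m) by apply: up.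
by have : p = (l', m') by [apply: up]; rewrite e1 => -[].
Qed.

Lemma kdeg0_id l : kdeg l = 0 -> l = kid L (krng l).
Proof.
move=> l0; have h := kcomp_idr l; have h' := kcomp_idl l.
have [||||//] := @kcomp_inj l (kid L (ksrc l)) (kid L (krng l)) l.
- by rewrite krng_id.
- by rewrite ksrc_id.
- by rewrite l0 kdeg_id.
- by rewrite h h'.
Qed.

(** Stated for all l, with the degree condition as a premise of the conclusion, so
that the two factors can be chosen by total functions. *)
Lemma ksplit_ex n l : exists p : kpath L * kpath L, dle n (kdeg l) ->
  [/\ ksrc p.1 = krng p.2, kdeg p.1 = n & l = kcomp p.1 p.2].
Proof.
case: (boolP (dle n (kdeg l))) => [/dle_addP[q e]|_]; last by exists (l, l).
by have [p [[]]] := kfact e; exists p.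
Qed.

Definition kpre n l : kpath L := (sval (cid (ksplit_ex n l))).1.
Definition ksuf n l : kpath L := (sval (cid (ksplit_ex n l))).2.

Lemma kpresufP n l : dle n (kdeg l) ->
  [/\ ksrc (kpre n l) = krng (ksuf n l), kdeg (kpre n l) = n
    & l = kcomp (kpre n l) (ksuf n l)].
Proof. by rewrite /kpre /ksuf; case: cid. Qed.

Lemma kpre_comp l m : ksrc l = krng m -> kpre (kdeg l) (kcomp l m) = l.
Proof.
move=> lm; have [|h d e] := @kpresufP (kdeg l) (kcomp l m).
  by rewrite kdeg_comp ?dle_addr.
by have [] := kcomp_inj h lm d (esym e).
Qed.

Lemma ksrc_suf n l : dle n (kdeg l) -> ksrc (ksuf n l) = ksrc l.
Proof. by move=> /kpresufP[h _ {2}->]; rewrite ksrc_comp. Qed.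

Lemma krng_pre n l : dle n (kdeg l) -> krng (kpre n l) = krng l.
Proof. by move=> /kpresufP[h _ {2}->]; rewrite krng_comp. Qed.

Lemma kpre_comp_le n l m : dle n (kdeg l) -> ksrc l = krng m ->
  kpre n (kcomp l m) = kpre n l.
Proof.
move=> nl lm; have [h d e] := kpresufP nl.
have h' : ksrc (ksuf n l) = krng m by rewrite ksrc_suf.
rewrite {1}e -kcompA // -{1}d kpre_comp // ?krng_comp //.
Qed.

Lemma kpre_pre p n l : dle p n -> dle n (kdeg l) ->
  kpre p (kpre n l) = kpre p l.
Proof.
move=> pn nl; have [h d e] := kpresufP nl.
by rewrite {2}e kpre_comp_le // d.
Qed.

End Factorisation.

(** * Infinite paths *)

Section Paths.
Variables (k : nat) (L : kgraph k).
Implicit Types (l m : kpath L) (n p q : degree k) (x y : infinite_path L).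

Definition segment x n : kpath L := x (omega_mk (dle_add0 n)).

Lemma segmentE x (a : omega_path k) :
  ksrc (segment x (omega_rng a)) = krng (x a) /\
  segment x (omega_src a) = kcomp (segment x (omega_rng a)) (x a).
Proof.
set b := omega_mk (dle_add0 (omega_rng a)).
have ba : @ksrc _ (Omega k) b = @krng _ (Omega k) a by [].
split; first by rewrite kmor_src kmor_rng.
rewrite -[RHS](@kmor_comp _ _ _ x b a) //; congr (kmor x _).
by apply: omega_eq => /=; rewrite ?omega_rng_comp ?omega_src_comp.
Qed.

Lemma kdeg_segment x n : kdeg (segment x n) = n.
Proof. by rewrite kmor_deg -[RHS](daddKl 0 n) add0r. Qed.

Lemma krng_segment x n : krng (segment x n) = path_vertex x 0.
Proof. by rewrite kmor_rng. Qed.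

Lemma ksrc_segment x n : ksrc (segment x n) = path_vertex x n.
Proof. by rewrite kmor_src. Qed.

Lemma segment0 x : segment x 0 = kid L (path_vertex x 0).
Proof. by rewrite -(krng_segment x 0); apply/kdeg0_id/kdeg_segment. Qed.

Lemma kpre_segment x n p : dle n p -> kpre n (segment x p) = segment x n.
Proof.
move=> np; have [h e] := segmentE x (omega_mk np).
by rewrite [segment x p]e -{1}(kdeg_segment x n) kpre_comp.
Qed.

Lemma infinite_path_eq x y : (forall n, segment x n = segment y n) -> x = y.
Proof.
move=> xy; apply: kmorphism_eq => a.
have [hx ex] := segmentE x a; have [hy ey] := segmentE y a.
by have [||//] := kcomp_inj hx hy; rewrite -?ex -?ey xy.
Qed.

(** Segments of degree n are determined by those of any larger degree. *)
Lemma infinite_path_eq_cofinal x y p :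
  (forall n, segment x (p + n) = segment y (p + n)) -> x = y.
Proof.
move=> xy; apply: infinite_path_eq => n.
have np : dle n (p + n) by rewrite addrC dle_addr.
by rewrite -(kpre_segment x np) -(kpre_segment y np) xy.
Qed.

Lemma segment_shift p x n :
  ksrc (segment x p) = krng (segment (shift p x) n) /\
  segment x (p + n) = kcomp (segment x p) (segment (shift p x) n).
Proof.
set a := omega_shift_path p (omega_mk (dle_add0 n)).
have [h e] := segmentE x a.
have ra : omega_rng a = p by exact: add0r.
have sa : omega_src a = p + n by exact: addrC.
by move: h e; rewrite ra sa.
Qed.

Lemma path_vertex_shift p x : path_vertex (shift p x) 0 = path_vertex x p.
Proof.
by have [h _] := segment_shift p x 0; rewrite krng_segment ksrc_segment in h.
Qed.

(** The value at (m, n) is the factor that remains when the segment of degree m is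
removed from the one of degree n; functoriality is unique factorisation. *)
Lemma infinite_path_of_segments (g : degree k -> kpath L) :
  (forall n, kdeg (g n) = n) ->
  (forall n p, dle n p -> kpre n (g p) = g n) ->
  exists x, forall n, segment x n = g n.
Proof.
move=> dg pg.
have sufP n p : dle n p -> [/\ ksrc (g n) = krng (ksuf n (g p)),
    kdeg (ksuf n (g p)) = dsub p n & g p = kcomp (g n) (ksuf n (g p))].
  move=> np; have [|h _ e] := @kpresufP _ _ n (g p); first by rewrite dg.
  rewrite pg // in h e; split=> //; apply: (@daddIl _ n).
  by rewrite dsubKC // -{1}(dg n) -kdeg_comp // -e dg.
pose ob n := ksrc (g n).
pose mor (a : omega_path k) := ksuf (omega_rng a) (g (omega_src a)).
have morP (a : omega_path k) := sufP _ _ (omega_le a).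
have mrng a : krng (mor a) = ob (omega_rng a) by have [] := morP a.
have msrc a : ksrc (mor a) = ob (omega_src a).
  by rewrite ksrc_suf // dg omega_le.
have mid n : mor (omega_id n) = kid L (ob n).
  have [h d e] := morP (omega_id n).
  by rewrite /ob h; apply: kdeg0_id; rewrite d; apply: omega_deg_id.
have mcomp a b : omega_src a = omega_rng b ->
    mor (omega_comp a b) = kcomp (mor a) (mor b).
  move=> ab; have [ha da ea] := morP a; have [hb db eb] := morP b.
  have [hc dc ec] := morP (omega_comp a b).
  rewrite omega_rng_comp // omega_src_comp // in hc ec.
  rewrite {1}/mor omega_rng_comp // omega_src_comp //.
  have hab : ksrc (mor a) = krng (mor b) by rewrite mrng msrc ab.
  have hc' : ksrc (g (omega_rng a)) = krng (kcomp (mor a) (mor b)).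
    by rewrite krng_comp.
  have [|_ //] := kcomp_inj hc hc' erefl.
  by rewrite -ec kcompA // -ea ab -eb.
have mdeg a : kdeg (mor a) = omega_deg a by have [] := morP a.
exists (@KMorphism k (Omega k) L ob mor mrng msrc mid mcomp mdeg) => n.
have [h d e] := sufP 0 n (dle_add0 n).
rewrite -[LHS]/(ksuf 0 (g n)) {2}e.
have -> : g 0 = kid L (krng (ksuf 0 (g n))).
  by rewrite -h (kdeg0_id (dg 0)) ksrc_id.
by rewrite kcomp_idl.
Qed.

Lemma concat_ex l x : path_vertex x 0 = ksrc l ->
  exists y, forall n, segment y n = kpre n (kcomp l (segment x n)).
Proof.
move=> xl; have h n : ksrc l = krng (segment x n) by rewrite krng_segment.
have nle n : dle n (kdeg (kcomp l (segment x n))).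
  by rewrite kdeg_comp // kdeg_segment addrC dle_addr.
apply: infinite_path_of_segments => [n|n p np].
  by have [] := kpresufP (nle n).
rewrite kpre_pre //.
have [h' ->] := segmentE x (omega_mk np).
rewrite kcompA //= kpre_comp_le ?ksrc_comp //; exact: nle.
Qed.

(** When the source of l is not the initial vertex of x the value is the dummy x. *)
Definition concat l x : infinite_path L :=
  if pselect (path_vertex x 0 = ksrc l) is left h then sval (cid (concat_ex h))
  else x.

Lemma segment_concat l x n : path_vertex x 0 = ksrc l ->
  segment (concat l x) (kdeg l + n) = kcomp l (segment x n).
Proof.
move=> xl; rewrite /concat; case: pselect => // {}xl; case: cid => y /= ->.
have h p : ksrc l = krng (segment x p) by rewrite krng_segment.
have np : dle n (kdeg l + n) by rewrite addrC dle_addr.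
have [h' ->] := segmentE x (omega_mk np).
have d : kdeg (kcomp l (segment x n)) = kdeg l + n.
  by rewrite kdeg_comp // kdeg_segment.
by rewrite kcompA //= -{1}d kpre_comp // ksrc_comp.
Qed.

Lemma segment_concat_deg l x : path_vertex x 0 = ksrc l ->
  segment (concat l x) (kdeg l) = l.
Proof.
move=> xl; have := segment_concat 0 xl.
by rewrite addr0 segment0 xl kcomp_idr.
Qed.

Lemma path_vertex_concat l x : path_vertex x 0 = ksrc l ->
  path_vertex (concat l x) 0 = krng l.
Proof.
by move=> xl; rewrite -(krng_segment _ (kdeg l)) segment_concat_deg.
Qed.

Lemma shift_concat l x : path_vertex x 0 = ksrc l ->
  shift (kdeg l) (concat l x) = x.
Proof.
move=> xl; apply: infinite_path_eq => n.
have [h] := segment_shift (kdeg l) (concat l x) n.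
rewrite segment_concat // segment_concat_deg // in h * => e.
by have [|_ ->] := kcomp_inj _ h erefl e; rewrite // krng_segment.
Qed.

Lemma concat_unique l x y : path_vertex x 0 = ksrc l ->
  (forall n, segment y (kdeg l + n) = kcomp l (segment x n)) ->
  y = concat l x.
Proof.
move=> xl h; apply: (@infinite_path_eq_cofinal _ _ (kdeg l)) => n.
by rewrite h segment_concat.
Qed.

Lemma path_vertex_shift_deg l x : segment x (kdeg l) = l ->
  path_vertex (shift (kdeg l) x) 0 = ksrc l.
Proof. by move=> xl; rewrite path_vertex_shift -ksrc_segment xl. Qed.

Lemma concat_shift l x : segment x (kdeg l) = l ->
  concat l (shift (kdeg l) x) = x.
Proof.
move=> xl; apply/esym/concat_unique; first exact: path_vertex_shift_deg.
by move=> n; have [_ ->] := segment_shift (kdeg l) x n; rewrite xl.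
Qed.

Lemma concat_comp l m x : ksrc l = krng m -> path_vertex x 0 = ksrc m ->
  concat (kcomp l m) x = concat l (concat m x).
Proof.
move=> lm xm; have h n : ksrc m = krng (segment x n) by rewrite krng_segment.
apply/esym/concat_unique; first by rewrite ksrc_comp.
move=> n; rewrite kdeg_comp // -addrA segment_concat ?path_vertex_concat //.
by rewrite segment_concat // kcompA.
Qed.

Hypothesis rfns : row_finite_no_sources L.

Lemma path_from_vertex v n : exists l, krng l = v /\ kdeg l = n.
Proof. by have [_ [l]] := rfns v n; exists l. Qed.

(** There are no sources: prolong the vertex v by paths of degree (1, ..., 1) again
and again; each degree n is reached after sum_i n_i steps. *)
Lemma infinite_path_from v : exists x, path_vertex x 0 = v.
Proof.
pose one : degree k := [ffun=> 1%N].
have [e eP] := choice (fun w => path_from_vertex w one).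
pose nu j := iter j (fun l => kcomp l (e (ksrc l))) (kid L v).
have eh l : ksrc l = krng (e (ksrc l)) by have [] := eP (ksrc l).
have nud j i : kdeg (nu j) i = j.
  elim: j => [|j IH] /=; first by rewrite kdeg_id ffunE.
  by rewrite kdeg_comp // (eP _).2 !ffunE IH; exact: addn1.
have nule n j : (\sum_i n i <= j)%N -> dle n (kdeg (nu j)).
  move=> nj; apply/forallP => i; rewrite nud; apply: leq_trans nj.
  by rewrite (bigD1 i) //= leq_addr.
have nupre n i j : (i <= j)%N -> dle n (kdeg (nu i)) ->
    kpre n (nu j) = kpre n (nu i).
  move=> ij ni; rewrite -(subnK ij); elim: (j - i)%N => //= d IH.
  rewrite kpre_comp_le //; apply/forallP => a; rewrite nud.
  by apply: leq_trans (forallP ni a) _; rewrite nud leq_addl.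
pose g n := kpre n (nu (\sum_i n i)%N).
have gd n : kdeg (g n) = n by have [] := kpresufP (nule n _ (leqnn _)).
have gp n p : dle n p -> kpre n (g p) = g n.
  move=> np; rewrite /g kpre_pre ?nule //.
  by apply: nupre (nule _ _ _) => //; apply: leq_sum => i _; exact: (forallP np).
have [x xg] := infinite_path_of_segments gd gp.
exists x; rewrite -(krng_segment x 0) xg krng_pre ?nule //.
by elim: (\sum_i _)%N => [|j IH] /=; rewrite ?krng_id // krng_comp.
Qed.

(** * Line points *)

(** Uniqueness of the infinite path from v means that there is one path of each
degree from v; if two paths from v, of degrees p and q, end at the same vertex,
then the infinite path has the same tail after p as after q.  This form of the
definition no longer mentions infinite paths, so it can be tested against the
relations of the algebra. *)
Lemma line_pointsP v : line_points L v <->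
  (forall l m, krng l = v -> krng m = v -> kdeg l = kdeg m -> l = m) /\
  (forall l m, krng l = v -> krng m = v -> ksrc l = ksrc m -> l = m).
Proof.
split=> [[x [xv xa]]|[one inj]].
  have uniqx y : path_vertex y 0 = v -> y = x.
    move=> yv; have : infinite_paths_from v y by [].
    by rewrite xv.
  have concatx l y : krng l = v -> path_vertex y 0 = ksrc l -> concat l y = x.
    by move=> lv yl; apply: uniqx; rewrite path_vertex_concat.
  have one l m : krng l = v -> krng m = v -> kdeg l = kdeg m -> l = m.
    move=> lv mv lm; have [y yl] := infinite_path_from (ksrc l).
    have [z zm] := infinite_path_from (ksrc m).
    have := segment_concat_deg yl; have := segment_concat_deg zm.
    by rewrite !concatx // lm => -> ->.
  split=> // l m lv mv lm; apply: one => //.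
  have [y yl] := infinite_path_from (ksrc l).
  have ym : path_vertex y 0 = ksrc m by rewrite yl.
  apply: contrapT => ne; apply: xa; exists (kdeg l), (kdeg m); split=> //.
  by have := shift_concat yl; have := shift_concat ym; rewrite !concatx // => -> ->.
have [x xv] := infinite_path_from v; exists x; split.
  apply/seteqP; split=> [y yv|_ ->//] /=; apply: infinite_path_eq => n.
  by apply: one; rewrite ?krng_segment ?kdeg_segment.
move=> [p [q [pq e]]]; apply: pq; rewrite -(kdeg_segment x p) -(kdeg_segment x q).
congr kdeg; apply: inj; rewrite ?krng_segment // !ksrc_segment.
by rewrite -(path_vertex_shift p) e path_vertex_shift.
Qed.

Lemma line_points_hereditary : hereditary (line_points L).
Proof.
move=> l /line_pointsP[one inj]; apply/line_pointsP; split=> a b ar br ab.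
  have [||||//] := @kcomp_inj k L l a l b; rewrite ?ar ?br //.
  by apply: one; rewrite ?krng_comp ?kdeg_comp ?ar ?br ?ab.
have [||||//] := @kcomp_inj k L l a l b; rewrite ?ar ?br //.
by apply: inj; rewrite ?krng_comp ?ksrc_comp ?ar ?br ?ab.
Qed.

End Paths.

(** * Ideals of non-unital algebras *)

Section NonUnitalAlgebra.
Variables (K : fieldType) (A : nuAlgType K).
Implicit Types (x y z : A).

Lemma amul0l x : amul 0 x = 0.
Proof. by rewrite -[X in amul X](scale0r (0 : A)) amulZl scale0r. Qed.

Lemma amul0r x : amul x 0 = 0.
Proof. by rewrite -[X in amul _ X](scale0r (0 : A)) amulZr scale0r. Qed.

Lemma amul_suml I (r : seq I) (P : pred I) (F : I -> A) y :
  amul (\sum_(i <- r | P i) F i) y = \sum_(i <- r | P i) amul (F i) y.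
Proof.
exact: (big_morph (amul^~ y) (fun u v => amulDl u v y) (amul0l y)).
Qed.

Lemma amul_sumr I (r : seq I) (P : pred I) (F : I -> A) x :
  amul x (\sum_(i <- r | P i) F i) = \sum_(i <- r | P i) amul x (F i).
Proof. exact: (big_morph (amul x) (amulDr x) (amul0r x)). Qed.

End NonUnitalAlgebra.

Section IdealLemmas.
Variables (K : fieldType) (A : nuAlgType K).
Implicit Types (I X : set A) (a b x y : A).

Lemma ideal_gen_ideal X : two_sided_ideal (ideal_gen X).
Proof.
split; first split; first split.
- by move=> I [[[[]]]].
- by move=> x y hx hy I hI; have [[[[_ D _] _] _] _] := hI; apply: D; [apply: hx|apply: hy].
- by move=> c x hx I hI; have [[[[_ _ Z] _] _] _] := hI; apply: Z; apply: hx.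
- by move=> a x hx I hI; have [[[_ h] _] _] := hI; apply: h; apply: hx.
- by move=> a x hx I hI; have [[_ h] _] := hI; apply: h; apply: hx.
Qed.

Lemma sub_ideal_gen X : X `<=` ideal_gen X.
Proof. exact: sub_smallest. Qed.

Lemma ideal_gen_sub X I : two_sided_ideal I -> X `<=` I -> ideal_gen X `<=` I.
Proof. by move=> hI XI; exact: smallest_sub. Qed.

Lemma subspace_sum (T : eqType) (r : seq T) (P : pred T) (F : T -> A) I : subspace I ->
  (forall i, i \in r -> P i -> I (F i)) -> I (\sum_(i <- r | P i) F i).
Proof.
move=> [I0 ID _] h; rewrite big_seq_cond; elim/big_ind: _ => // i /andP[ir Pi].
exact: h.
Qed.

(** Right multiplication by a is a homomorphism of left modules, so the image of a
simple module is simple or zero. *)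
Lemma minimal_left_ideal_mulr I a : minimal_left_ideal I ->
  (exists2 x, I x & amul x a != 0) ->
  minimal_left_ideal [set amul x a | x in I].
Proof.
move=> [Il _ Imin] [x0 Ix0 x0a].
have [[I0 ID IZ] Im] := Il.
split; first split; first split.
- by exists 0; rewrite ?amul0l.
- by move=> _ _ [x Ix <-] [y Iy <-]; exists (x + y); rewrite ?amulDl //; exact: ID.
- by move=> c _ [x Ix <-]; exists (c *: x); rewrite ?amulZl //; exact: IZ.
- by move=> b _ [x Ix <-]; exists (amul b x); rewrite ?amulA //; exact: Im.
- move=> e; case/eqP: x0a; have : [set amul x a | x in I] (amul x0 a) by exists x0.
  by rewrite e.
move=> I' [[I'0 I'D I'Z] I'm] I'I.
have [|x []//|J0|JI] := Imin [set x | I x /\ I' (amul x a)].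
- split; first split; first by rewrite /= amul0l.
    by move=> x y [Ix xa] [Iy ya]; split; rewrite ?amulDl; [exact: ID|exact: I'D].
    by move=> c x [Ix xa]; split; rewrite ?amulZl; [exact: IZ|exact: I'Z].
  by move=> b x [Ix xa]; split; rewrite -?amulA; [exact: Im|exact: I'm].
- left; apply/seteqP; split=> [y I'y|_ ->//].
  have [x Ix xy] := I'I y I'y; have : [set x | I x /\ I' (amul x a)] x.
    by split; rewrite ?xy.
  by rewrite J0 /= -xy => ->; rewrite amul0l.
- right; apply/seteqP; split=> // _ [x Ix <-].
  by move: Ix; rewrite -JI => -[].
Qed.

Lemma socle_ideal : two_sided_ideal (socle A).
Proof.
split; first split; first split.
- by exists [::]; rewrite big_nil.
- move=> _ _ [s [hs ->]] [s' [hs' ->]]; exists (s ++ s'); rewrite big_cat.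
  by split=> // x; rewrite mem_cat => /orP[/hs|/hs'].
- move=> c _ [s [hs ->]]; exists [seq c *: x | x <- s]; rewrite big_map scaler_sumr.
  split=> // _ /mapP[x /hs[I [Imin Ix]] ->]; exists I; split=> //.
  by case: Imin => -[[_ _ IZ] _] _ _; apply: IZ.
- move=> a _ [s [hs ->]]; exists [seq amul a x | x <- s]; rewrite big_map amul_sumr.
  split=> // _ /mapP[x /hs[I [Imin Ix]] ->]; exists I; split=> //.
  by case: Imin => -[_ Im] _ _; apply: Im.
move=> a _ [s [hs ->]]; exists [seq amul x a | x <- s]; rewrite big_map amul_suml.
split=> // _ /mapP[x /hs[I [Imin Ix]] ->].
have [xa0|xa] := eqVneq (amul x a) 0.
  by exists I; split=> //; rewrite xa0; case: Imin => -[[]].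
exists [set amul y a | y in I]; split; last by exists x.
by apply: minimal_left_ideal_mulr Imin _; exists x.
Qed.

Lemma socle_sub I : subspace I ->
  (forall M, minimal_left_ideal M -> M `<=` I) -> socle A `<=` I.
Proof.
move=> hI h _ [s [hs ->]]; apply: subspace_sum => // x /hs[M [Mmin Mx]] _.
exact: h Mx.
Qed.

End IdealLemmas.

(** * The Kumjian-Pask relations for paths of every degree *)

Section Calculus.
Variables (k : nat) (L : kgraph k) (K : fieldType).
Hypothesis rfns : row_finite_no_sources L.
Local Notation A := (KP K L).
Implicit Types (l m a b : kpath L) (v w : kvertex L) (n : degree k) (x y z : A).

Definition paths v n : seq (kpath L) :=
  undup (sval (cid ((finite_seqP _).1 (rfns v n).1))).

Lemma mem_paths v n l : (l \in paths v n) <-> krng l = v /\ kdeg l = n.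
Proof.
rewrite mem_undup; case: cid => s /= e.
by rewrite -[krng l = v /\ _]/(paths_from v n l) e.
Qed.

Lemma paths_uniq v n : uniq (paths v n).
Proof. exact: undup_uniq. Qed.

(** Turns the sums of (KP4), over a set of paths of nonzero degree, into sums over
a list of plain paths. *)
Lemma npath_sum (B : nmodType) (F : npath L -> B) (G : kpath L -> B) v n :
  n != 0 -> (forall u, F u = G (val u)) ->
  \sum_(l \in [set l : npath L | paths_from v n (val l)]) F l =
  \sum_(l <- paths v n) G l.
Proof.
move=> n0 FG; pose s : seq (npath L) := pmap insub (paths v n).
have sE : [set l : npath L | paths_from v n (val l)] = [set` s].
  apply/seteqP; split=> l /=; rewrite mem_pmap_sub.
    by move=> ?; apply/mem_paths.
  by move=> /mem_paths.
rewrite sE -fsbig_seq; last exact/pmap_sub_uniq/paths_uniq.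
have all0 : all (fun l => kdeg l != 0) (paths v n).
  by apply/allP => l /mem_paths[_ ->].
have -> : paths v n = map val s.
  rewrite pmap_filter; last exact: insubK.
  by rewrite (eq_filter (isSome_insub _)) (all_filterP all0).
by rewrite big_map; apply: eq_bigr.
Qed.

(** The generators are indexed by paths of nonzero degree.  Letting paths of degree
zero stand for their vertex makes the relations uniform. *)
Definition kpS l : A :=
  if insub l is Some l' then kp_s K (l' : npath L) else kp_p K (krng l).
Definition kpT l : A :=
  if insub l is Some l' then kp_t K (l' : npath L) else kp_p K (krng l).

Lemma kpS_np (l : npath L) : kpS (val l) = kp_s K l.
Proof. by rewrite /kpS valK. Qed.

Lemma kpT_np (l : npath L) : kpT (val l) = kp_t K l.
Proof. by rewrite /kpT valK. Qed.

Lemma kpath_case (P : kpath L -> Prop) :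
  (forall v, P (kid L v)) -> (forall l : npath L, P (val l)) -> forall l, P l.
Proof.
move=> P0 P1 l; have [/eqP/kdeg0_id ->//|h] := boolP (kdeg l == 0).
exact: (P1 (Sub l h)).
Qed.

Lemma kpS_id v : kpS (kid L v) = kp_p K v.
Proof. by rewrite /kpS insubN ?krng_id // kdeg_id eqxx. Qed.

Lemma kpT_id v : kpT (kid L v) = kp_p K v.
Proof. by rewrite /kpT insubN ?krng_id // kdeg_id eqxx. Qed.

Let f := kp_fam K rfns.

Lemma mul_pp v w : amul (kp_p K v) (kp_p K w) = if v == w then kp_p K v else 0.
Proof. exact: (fam_KP1 f). Qed.

Lemma mul_pS l : amul (kp_p K (krng l)) (kpS l) = kpS l.
Proof.
move: l; apply: kpath_case => [v|l]; last by rewrite kpS_np; exact: (fam_KP2ps f).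
by rewrite krng_id kpS_id mul_pp eqxx.
Qed.

Lemma mul_Sp l : amul (kpS l) (kp_p K (ksrc l)) = kpS l.
Proof.
move: l; apply: kpath_case => [v|l]; last by rewrite kpS_np; exact: (fam_KP2sp f).
by rewrite ksrc_id kpS_id mul_pp eqxx.
Qed.

Lemma mul_pT l : amul (kp_p K (ksrc l)) (kpT l) = kpT l.
Proof.
move: l; apply: kpath_case => [v|l]; last by rewrite kpT_np; exact: (fam_KP2pt f).
by rewrite ksrc_id kpT_id mul_pp eqxx.
Qed.

Lemma mul_Tp l : amul (kpT l) (kp_p K (krng l)) = kpT l.
Proof.
move: l; apply: kpath_case => [v|l]; last by rewrite kpT_np; exact: (fam_KP2tp f).
by rewrite krng_id kpT_id mul_pp eqxx.
Qed.

Lemma degree_add_eq0 n n' : n + n' = 0 -> n = 0.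
Proof.
move=> h; apply/ffunP => i; have /eqP := congr1 (fun g : degree k => g i) h.
by rewrite !ffunE addn_eq0 => /andP[/eqP].
Qed.

Lemma mul_SS l m : ksrc l = krng m -> amul (kpS l) (kpS m) = kpS (kcomp l m).
Proof.
move: l; apply: kpath_case => [v|l].
  by rewrite ksrc_id => ->; rewrite kpS_id mul_pS kcomp_idl.
move: m; apply: kpath_case => [v|m].
  by rewrite krng_id => <-; rewrite kpS_id mul_Sp kcomp_idr.
move=> lm; have h : kdeg (kcomp (val l) (val m)) != 0.
  apply/negP => /eqP; rewrite kdeg_comp // => /degree_add_eq0/eqP.
  exact/negP/(valP l).
rewrite !kpS_np -[kcomp _ _]/(val (Sub (kcomp (val l) (val m)) h : npath L)).
by rewrite kpS_np; exact: (fam_KP2s f).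
Qed.

Lemma mul_TT l m : ksrc l = krng m -> amul (kpT m) (kpT l) = kpT (kcomp l m).
Proof.
move: l; apply: kpath_case => [v|l].
  by rewrite ksrc_id => ->; rewrite kpT_id mul_Tp kcomp_idl.
move: m; apply: kpath_case => [v|m].
  by rewrite krng_id => <-; rewrite kpT_id mul_pT kcomp_idr.
move=> lm; have h : kdeg (kcomp (val l) (val m)) != 0.
  apply/negP => /eqP; rewrite kdeg_comp // => /degree_add_eq0/eqP.
  exact/negP/(valP l).
rewrite !kpT_np -[kcomp _ _]/(val (Sub (kcomp (val l) (val m)) h : npath L)).
by rewrite kpT_np; exact: (fam_KP2t f).
Qed.

Lemma mul_TS l m : kdeg l = kdeg m ->
  amul (kpT l) (kpS m) = if l == m then kp_p K (ksrc l) else 0.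
Proof.
move: m l; apply: kpath_case => [w|m]; apply: kpath_case => [v|l].
- move=> _; rewrite kpT_id kpS_id mul_pp ksrc_id; congr (if _ then _ else _).
  by apply/eqP/eqP => [->|e] //; rewrite -(krng_id v) e krng_id.
- by rewrite kdeg_id => /eqP; rewrite (negPf (valP l)).
- by rewrite kdeg_id => /esym/eqP; rewrite (negPf (valP m)).
- by rewrite kpT_np kpS_np val_eqE; exact: (fam_KP3 f).
Qed.

Lemma p_sum v n : kp_p K v = \sum_(l <- paths v n) amul (kpS l) (kpT l).
Proof.
have [->|n0] := eqVneq n 0.
  have -> : paths v 0 = [:: kid L v].
    apply/perm_small_eq => //; apply: uniq_perm => [||l]; [exact: paths_uniq|by []|].
    rewrite mem_seq1; apply/idP/eqP => [/mem_paths[<- /kdeg0_id//]|->].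
    by apply/mem_paths; rewrite krng_id kdeg_id.
  by rewrite big_seq1 kpS_id kpT_id mul_pp eqxx.
rewrite [LHS](fam_KP4 f v n0).
by apply: (npath_sum (G := fun l => amul (kpS l) (kpT l))) => // u; rewrite kpS_np kpT_np.
Qed.

Lemma mul_TS_suf l m : dle (kdeg l) (kdeg m) ->
  amul (kpT l) (kpS m) =
    if kpre (kdeg l) m == l then kpS (ksuf (kdeg l) m) else 0.
Proof.
move=> /kpresufP[h d e]; rewrite {1}e -mul_SS // amulA mul_TS ?d //.
rewrite eq_sym; case: eqP => [e1|_]; last by rewrite amul0l.
by rewrite -{1}e1 h mul_pS.
Qed.

(** Prolonging all paths to a large degree is what makes two arbitrary paths
comparable in [mul_TS_suf]. *)
Lemma S_sum l n :
  kpS l = \sum_(m <- paths (ksrc l) n) amul (kpS (kcomp l m)) (kpT m).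
Proof.
rewrite -{1}mul_Sp (p_sum _ n) amul_sumr big_seq [RHS]big_seq.
by apply: eq_bigr => m /mem_paths[ml _]; rewrite amulA mul_SS.
Qed.

(** Induction along the spanning family of the S_l T_m.  The span is closed under
multiplication because, in T_m S_a, the factor S_a is a sum of terms S_(a t) T_t
with a t of degree at least that of m; then m is either an initial segment of a t,
which is cancelled, or kills the term. *)
Lemma KP_ind (P : A -> Prop) :
  P 0 -> (forall x y, P x -> P y -> P (x + y)) ->
  (forall c x, P x -> P (c *: x)) ->
  (forall l m, ksrc l = ksrc m -> P (amul (kpS l) (kpT m))) ->
  forall x, P x.
Proof.
move=> P0 PD PZ Pst x.
(* The span, as the intersection of all subspaces containing the family. *)
pose closed (Q : A -> Prop) := [/\ Q 0, forall x y, Q x -> Q y -> Q (x + y),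
  forall c x, Q x -> Q (c *: x)
  & forall l m, ksrc l = ksrc m -> Q (amul (kpS l) (kpT m))].
pose span x := forall Q, closed Q -> Q x.
have span0 : span 0 by move=> Q [].
have spanD y z : span y -> span z -> span (y + z).
  by move=> sy sz Q cQ; have [_ QD _ _] := cQ; apply: QD; [apply: sy|apply: sz].
have spanZ c y : span y -> span (c *: y).
  by move=> sy Q cQ; have [_ _ QZ _] := cQ; apply: QZ; apply: sy.
have spanST l m : ksrc l = ksrc m -> span (amul (kpS l) (kpT m)).
  by move=> lm Q [_ _ _]; apply.
have spanP v : span (kp_p K v).
  have := spanST (kid L v) (kid L v) erefl.
  by rewrite kpS_id kpT_id mul_pp eqxx.
have span_sum (r : seq (kpath L)) F : (forall i, i \in r -> span (F i)) -> span (\sum_(i <- r) F i).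
  by move=> h; rewrite big_seq; elim/big_ind: _.
have spanM y z : span y -> span z -> span (amul y z).
  move=> sy; move: z; apply: (sy (fun y => forall z, span z -> span (amul y z))).
  split=> [z _|u w hu hw z sz|c u hu z sz|l m lm z sz].
  - by rewrite amul0l.
  - by rewrite amulDl; apply: spanD; [apply: hu|apply: hw].
  - by rewrite amulZl; apply: spanZ; apply: hu.
  apply: (sz (fun z => span (amul (amul (kpS l) (kpT m)) z))).
  split=> [|u w hu hw|c u hu|a b ab].
  - by rewrite amul0r.
  - by rewrite amulDr; apply: spanD.
  - by rewrite amulZr; apply: spanZ.
  rewrite (S_sum a (kdeg m)) amul_suml amul_sumr.
  apply: span_sum => t /mem_paths[ta td].
  have at_ : ksrc a = krng t by rewrite ta.
  rewrite -(amulA (kpS (kcomp a t))) mul_TT -?ab ?ta //.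
  rewrite amulA -(amulA (kpS l)) mul_TS_suf; last first.
    by rewrite kdeg_comp // td addrC dle_addr.
  case: eqP => [e|_]; last by rewrite amul0r amul0l.
  have [|h d e'] := @kpresufP _ _ (kdeg m) (kcomp a t).
    by rewrite kdeg_comp // td addrC dle_addr.
  have bt : ksrc b = krng t by rewrite -ab ta.
  rewrite e -lm in h; rewrite mul_SS //; apply: spanST.
  by rewrite !ksrc_comp // ksrc_suf ?ksrc_comp // kdeg_comp // td addrC dle_addr.
suff: span x by apply.
rewrite -[x]kp_reprK; elim: (repr x) => {x} [v|l|l||t IHt u IHu|c t IHt|t IHt u IHu].
- exact: spanP.
- rewrite -[kp_class _]/(kp_s K l) -kpS_np -mul_Sp -kpT_id.
  by apply: spanST; rewrite ksrc_id.
- rewrite -[kp_class _]/(kp_t K l) -kpT_np -mul_pT -kpS_id.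
  by apply: spanST; rewrite ksrc_id.
- exact: span0.
- suff -> : kp_class (TAdd t u) = kp_class t + kp_class u by apply: spanD.
  by apply/kp_classP => B' g /=; rewrite !kp_reprE.
- suff -> : kp_class (TScale c t) = c *: kp_class t by apply: spanZ.
  by apply/kp_classP => B' g /=; rewrite !kp_reprE.
- suff -> : kp_class (TMul t u) = amul (kp_class t) (kp_class u) by apply: spanM.
  by apply/kp_classP => B' g /=; rewrite !kp_reprE.
Qed.

End Calculus.

(** * Reduction to linear combinations of paths *)

Section Combinations.
Variables (k : nat) (L : kgraph k) (K : fieldType).
Hypothesis rfns : row_finite_no_sources L.
Local Notation A := (KP K L).
Implicit Types (l m a b : kpath L) (v w : kvertex L) (n : degree k) (x y z : A).
Implicit Types (s : seq (K * kpath L)).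

Definition comb s : A := \sum_(c <- s) c.1 *: kpS K c.2.

(** The normal form of a combination whose paths end at v: each nonzero one can be
brought to it ([reduce_comb]), and nothing in it vanishes ([comb_neq0]). *)
Definition reduced v s :=
  [/\ s != [::], uniq (map snd s), all (fun c => c.1 != 0) s
    & all (fun c => ksrc c.2 == v) s].

Definition extend_by l s := [seq (c.1, kcomp c.2 l) | c <- s].

Lemma comb_mulS l s : all (fun c => ksrc c.2 == krng l) s ->
  amul (comb s) (kpS K l) = comb (extend_by l s).
Proof.
move=> /allP sl; rewrite amul_suml /comb big_map big_seq [RHS]big_seq.
by apply: eq_bigr => c /sl/eqP cl; rewrite amulZl mul_SS.
Qed.

Lemma kcompIr l a b : ksrc a = krng l -> ksrc b = krng l ->
  kcomp a l = kcomp b l -> a = b.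
Proof.
move=> al bl e; have [||||//] := @kcomp_inj k L a l b l; rewrite ?al ?bl //.
have := congr1 (@kdeg k L) e; rewrite !kdeg_comp // => h.
by apply: (@daddIl _ (kdeg l)); rewrite addrC h addrC.
Qed.

Lemma reduced_extend l s : reduced (krng l) s -> reduced (ksrc l) (extend_by l s).
Proof.
move=> [s0 su sc /allP sl]; split.
- by case: s s0 {su sc sl}.
- rewrite -map_comp (map_comp (fun a => kcomp a l) snd) map_inj_in_uniq //.
  move=> a b /mapP[c /sl/eqP cl ->] /mapP[d /sl/eqP dl ->].
  exact: kcompIr.
- by rewrite all_map.
- by rewrite all_map; apply/allP => c /sl/eqP cl /=; rewrite ksrc_comp.
Qed.

(** Collect equal paths and drop those whose total coefficient vanishes. *)
Lemma reduce_comb v s : all (fun c => ksrc c.2 == v) s -> comb s != 0 ->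
  exists s', reduced v s' /\ comb s' = comb s.
Proof.
move=> /allP sv s0.
pose coef a := \sum_(c <- s | c.2 == a) c.1.
pose s1 := [seq (coef a, a) | a <- undup (map snd s)].
pose s' := [seq c <- s1 | c.1 != 0].
have e : comb s' = comb s.
  rewrite /comb big_filter big_rmcond; last first.
    by move=> c /negPn/eqP ->; rewrite scale0r.
  rewrite big_map /= (eq_bigr (fun a => \sum_(c <- s | c.2 == a) c.1 *: kpS K c.2)).
    rewrite (exchange_big_dep predT) //= big_seq [RHS]big_seq.
    apply: eq_bigr => c cs; under eq_bigl do rewrite eq_sym.
    by rewrite -big_filter filter_pred1_uniq ?undup_uniq ?mem_undup ?map_f ?big_seq1.
  by move=> a _; rewrite scaler_suml; apply: eq_bigr => c /eqP ->.
exists s'; split=> //; split.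
- by apply: contraNneq s0 => s'0; rewrite -e s'0 /comb big_nil.
- have -> : map snd s' = [seq a <- undup (map snd s) | coef a != 0].
    by rewrite /s' /s1 filter_map -map_comp map_id_in.
  by rewrite filter_uniq ?undup_uniq.
- exact: filter_all.
- apply/allP => c; rewrite mem_filter => /andP[_ /mapP[a]].
  by rewrite mem_undup => /mapP[d ds ->] ->; exact: (sv d ds).
Qed.

(** A path longer than all the ghost paths occurring in x absorbs them. *)
Lemma mulS_comb x : exists N, forall l, dle N (kdeg l) ->
  exists s, all (fun c => ksrc c.2 == ksrc l) s /\ amul x (kpS K l) = comb s.
Proof.
move: x; apply: (KP_ind rfns) => [|x y [N hN] [M hM]|c x [N hN]|a b ab].
- by exists 0 => l _; exists [::]; rewrite /comb big_nil amul0l.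
- exists (N + M) => l NM.
  have [s [sl es]] := hN l (dle_trans (dle_addr N M) NM).
  have MN : dle M (N + M) by rewrite addrC dle_addr.
  have [s' [sl' es']] := hM l (dle_trans MN NM).
  by exists (s ++ s'); rewrite all_cat sl sl' amulDl es es' /comb big_cat.
- exists N => l /hN[s [sl es]]; exists [seq (c * d.1, d.2) | d <- s].
  rewrite all_map; split=> //; rewrite amulZl es /comb big_map scaler_sumr.
  by apply: eq_bigr => d _; rewrite scalerA.
- exists (kdeg b) => l bl; rewrite -amulA mul_TS_suf //.
  case: eqP => [e|_]; last first.
    by exists [::]; rewrite amul0r /comb big_nil.
  have [h _ _] := kpresufP bl; rewrite e -ab in h.
  exists [:: (1, kcomp a (ksuf (kdeg b) l))].
  by rewrite /= ksrc_comp // ksrc_suf // eqxx mul_SS // /comb big_seq1 scale1r.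
Qed.

(** The algebra may lack a unit, but finitely many vertices act as one on a given
element; the statement allows enlarging their set so that it adds up. *)
Lemma local_units x : exists2 V : seq (kvertex L), uniq V &
  forall V', uniq V' -> {subset V <= V'} ->
    amul x (\sum_(v <- V') kp_p K v) = x /\ amul (\sum_(v <- V') kp_p K v) x = x.
Proof.
have pV V v : uniq V -> v \in V ->
    amul (kp_p K v) (\sum_(w <- V) kp_p K w) = kp_p K v /\
    amul (\sum_(w <- V) kp_p K w) (kp_p K v) = kp_p K v.
  move=> Vu vV; rewrite amul_suml amul_sumr (bigD1_seq v) //=.
  rewrite [in X in _ /\ X](bigD1_seq v) //= !mul_pp // eqxx !big1 ?addr0 // => w wv.
  by rewrite mul_pp // (negPf wv).
  by rewrite mul_pp // eq_sym (negPf wv).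
move: x; apply: (KP_ind rfns) => [|x y [V Vu hV] [W Wu hW]|c x [V Vu hV]|a b ab].
- by exists [::] => // V _ _; rewrite amul0l amul0r.
- exists (undup (V ++ W)); rewrite ?undup_uniq // => U Uu VW.
  have [||ex ex'] := hV U => //.
    by move=> v vV; apply: VW; rewrite mem_undup mem_cat vV.
  have [||ey ey'] := hW U => //.
    by move=> v vV; apply: VW; rewrite mem_undup mem_cat vV orbT.
  by rewrite amulDl amulDr ex ex' ey ey'.
- by exists V => // U Uu /(hV U Uu)[e e']; rewrite amulZl amulZr e e'.
- exists (undup [:: krng a; krng b]); rewrite ?undup_uniq // => U Uu ab'.
  have aU : krng a \in U by apply: ab'; rewrite mem_undup !inE eqxx.
  have bU : krng b \in U by apply: ab'; rewrite mem_undup !inE eqxx orbT.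
  split; first by rewrite -(mul_Tp K rfns b) -!amulA (pV _ _ Uu bU).1.
  by rewrite -(mul_pS K rfns a) !amulA (pV _ _ Uu aU).2.
Qed.

Lemma left_unit x : exists u, amul u x = x.
Proof.
have [V Vu hV] := local_units x.
by exists (\sum_(v <- V) kp_p K v); have [] := hV V Vu.
Qed.

Lemma mulp_eq0 x : (forall v, amul x (kp_p K v) = 0) -> x = 0.
Proof.
move=> h; have [V Vu hV] := local_units x; have [//|<- _] := hV V Vu.
by rewrite amul_sumr big1.
Qed.

(** If x S_l vanished for all l of some large degree, (KP4) would make x p_v vanish
for every vertex v, hence x itself. *)
Lemma reduction x : x != 0 ->
  exists l s, [/\ reduced (ksrc l) s, amul x (kpS K l) = comb s & comb s != 0].
Proof.
move=> x0; have [N hN] := mulS_comb x.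
have [l lN xl] : exists2 l, kdeg l = N & amul x (kpS K l) != 0.
  apply: contrapT => h; case/eqP: x0; apply: mulp_eq0 => v.
  rewrite (p_sum K rfns v N) amul_sumr big_seq big1 // => l /mem_paths[_ lN].
  rewrite amulA; have [->|xl] := eqVneq (amul x (kpS K l)) 0; first by rewrite amul0l.
  by case: h; exists l.
have [|s [sl es]] := hN l; first by rewrite lN dle_refl.
rewrite es in xl; have [s' [s'r e]] := reduce_comb sl xl.
by exists l, s'; rewrite e.
Qed.

End Combinations.

(** * Weights of degrees *)

Section Weights.
Variable k : nat.
Implicit Types (n m : degree k) (w : 'I_k -> nat).

Definition weight w n : nat := (\sum_(i < k) n i * w i)%N.

Lemma weightD w m n : weight w (m + n) = (weight w m + weight w n)%N.
Proof.
by rewrite /weight -big_split; apply: eq_bigr => i _; rewrite ffunE mulnDl.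
Qed.

Lemma weight0 w : weight w 0 = 0%N.
Proof. by rewrite /weight big1 // => i _; rewrite ffunE mul0n. Qed.

(** Regard degrees as coefficients of polynomials: finitely many distinct ones take
distinct values at some natural number N, and the weights are the powers of N. *)
Lemma injective_weight (D : seq (degree k)) :
  exists w, {in D &, injective (weight w)}.
Proof.
pose P n : {poly rat} := \sum_(i < k) (n i)%:R *: 'X^i.
have Pi (i : 'I_k) n : (P n)`_i = (n i)%:R.
  rewrite coef_sum (bigD1 i) //= coefZ coefXn eqxx mulr1 big1 ?addr0 // => j ji.
  by rewrite coefZ coefXn eq_sym (inj_eq val_inj) (negPf ji) mulr0.
have Pinj m n : P m = P n -> m = n.
  move=> e; apply/ffunP => i; have := Pi i m; rewrite e Pi => /eqP.
  by rewrite Num.Theory.eqr_nat => /eqP.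
pose Q := \prod_(m <- D) \prod_(n <- D | m != n) (P m - P n).
have Q0 : Q != 0.
  rewrite prodf_seq_neq0; apply/allP => m _ /=.
  rewrite prodf_seq_neq0; apply/allP => n _ /=; apply/implyP => mn.
  by rewrite subr_eq0; apply: contraNneq mn => /Pinj ->.
have [N QN] : exists N : nat, Q.[N%:R] != 0.
  apply: contrapT => h; pose rs : seq rat := [seq i%:R | i <- iota 0 (size Q)].
  have : (size rs < size Q)%N.
    apply: max_poly_roots => //.
      apply/allP => _ /mapP[i _ ->]; apply: contrapT => /negP Qi.
      by apply: h; exists i.
    by rewrite map_inj_uniq ?iota_uniq // => i j /eqP; rewrite Num.Theory.eqr_nat => /eqP.
  by rewrite size_map size_iota ltnn.
(* Two degrees of equal weight would give a vanishing factor of Q at N. *)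
exists (fun i => N ^ i)%N => m n mD nD mn; apply: contrapT => /eqP ne.
case/negP: QN; rewrite /Q horner_prod (big_rem m) //= horner_prod (big_rem n) //= ne.
suff -> : (P m - P n).[N%:R] = 0 by rewrite !mul0r.
have PN p : (P p).[N%:R] = (weight (fun i => N ^ i)%N p)%:R.
  rewrite horner_sum natr_sum; apply: eq_bigr => i _.
  by rewrite hornerZ hornerXn natrM natrX.
by rewrite hornerD hornerN !PN mn subrr.
Qed.

Lemma coef_sum_Xn (K : fieldType) (T : eqType) (s : seq T) (a : T -> K) e c :
  uniq s -> {in s &, injective e} -> c \in s ->
  (\sum_(d <- s) a d *: 'X^(e d))`_(e c) = a c.
Proof.
move=> su ei cs; rewrite coef_sum (bigD1_seq c) //= coefZ coefXn eqxx mulr1.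
rewrite big_seq_cond big1 ?addr0 // => d /andP[ds dc].
by rewrite coefZ coefXn (inj_in_eq ei) // eq_sym (negPf dc) mulr0.
Qed.

(** A divisor of a power of the variable is a monomial: this is why a Laurent
polynomial with two terms is not invertible. *)
Lemma dvd_Xn_coef (K : fieldType) (q : {poly K}) N i j :
  q %| 'X^N -> q`_i != 0 -> q`_j != 0 -> i = j.
Proof.
rewrite -['X]subr0 => /dvdp_exp_XsubCP[d _]; rewrite subr0.
move=> /eqpP[[a b] /= /andP[a0 b0] e] qi qj.
have h r : q`_r != 0 -> r = d.
  move=> qr; have := congr1 (fun p : {poly K} => p`_r) e.
  rewrite !coefZ coefXn; case: eqP => // _ /eqP; rewrite mulr0 mulf_eq0.
  by rewrite (negPf a0) (negPf qr).
by rewrite (h i qi) (h j qj).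
Qed.

End Weights.

(** * Algebras of linear operators *)

Section LinearOperators.
Variables (K E : fieldType) (V : lmodType E).

(** The linear maps over E, to be made an algebra over K by restricting scalars
along io.  The parameter io appears in the type only to determine that
structure. *)
Record linop (io : K -> E) := LinOp {
  linop_fun :> V -> V;
  linop_linear : `[< linear linop_fun >]
}.

Variable io : {rmorphism K -> E}.
Local Notation op := (linop io).

HB.instance Definition _ := [isSub for @linop_fun io].
HB.instance Definition _ := [Choice of op by <:].

Lemma linopP (f g : op) : f =1 g -> f = g.
Proof. by move=> fg; apply: val_inj; apply/funext. Qed.

Lemma linopD (f : op) : {morph f : u v / u + v}.
Proof.
by move=> u v; have /asboolP h := linop_linear f; rewrite -[u]scale1r h !scale1r.
Qed.

Lemma linopZ (f : op) c u : f (c *: u) = c *: f u.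
Proof.
have /asboolP h := linop_linear f.
have := h (-1) 0 0; rewrite scaler0 addr0 scaleN1r addNr => f0.
by rewrite -[c *: u]addr0 h f0 addr0.
Qed.

Definition mk_linop (f : V -> V) (h : linear f) : op := LinOp io (asboolT h).

Fact add_linear (f g : op) : linear (fun u => f u + g u).
Proof. by move=> c u v; rewrite !linopD !linopZ scalerDr addrACA. Qed.
Fact opp_linear (f : op) : linear (fun u => - f u).
Proof. by move=> c u v; rewrite linopD linopZ opprD scalerN. Qed.
Fact zero_linear : linear (fun _ : V => 0 : V).
Proof. by move=> c u v; rewrite scaler0 addr0. Qed.
Fact scale_linear (c : K) (f : op) : linear (fun u => io c *: f u).
Proof. by move=> d u v; rewrite linopD linopZ scalerDr !scalerA mulrC. Qed.
Fact mul_linear (f g : op) : linear (fun u => f (g u)).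
Proof. by move=> c u v; rewrite !linopD !linopZ. Qed.

Definition op_add f g := mk_linop (add_linear f g).
Definition op_opp f := mk_linop (opp_linear f).
Definition op_zero := mk_linop zero_linear.
Definition op_scale c f := mk_linop (scale_linear c f).
Definition op_mul f g := mk_linop (mul_linear f g).

Fact op_addA : associative op_add.
Proof. by move=> f g h; apply: linopP => u /=; rewrite addrA. Qed.
Fact op_addC : commutative op_add.
Proof. by move=> f g; apply: linopP => u /=; rewrite addrC. Qed.
Fact op_add0 : left_id op_zero op_add.
Proof. by move=> f; apply: linopP => u /=; rewrite add0r. Qed.
Fact op_addN : left_inverse op_zero op_opp op_add.
Proof. by move=> f; apply: linopP => u /=; rewrite addNr. Qed.

HB.instance Definition _ :=
  GRing.isZmodule.Build op op_addA op_addC op_add0 op_addN.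

Fact op_scaleA c d f : op_scale c (op_scale d f) = op_scale (c * d) f.
Proof. by apply: linopP => u /=; rewrite scalerA rmorphM. Qed.
Fact op_scale1 : left_id 1 op_scale.
Proof. by move=> f; apply: linopP => u /=; rewrite rmorph1 scale1r. Qed.
Fact op_scaleDr : right_distributive op_scale +%R.
Proof. by move=> c f g; apply: linopP => u /=; rewrite scalerDr. Qed.
Fact op_scaleDl f : {morph op_scale^~ f : c d / c + d}.
Proof. by move=> c d; apply: linopP => u /=; rewrite rmorphD scalerDl. Qed.

HB.instance Definition _ := GRing.Zmodule_isLmodule.Build K op
  op_scaleA op_scale1 op_scaleDr op_scaleDl.

Fact op_mulA f g h : op_mul f (op_mul g h) = op_mul (op_mul f g) h.
Proof. exact: linopP. Qed.
Fact op_mulDl f g h : op_mul (f + g) h = op_mul f h + op_mul g h.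
Proof. exact: linopP. Qed.
Fact op_mulDr f g h : op_mul f (g + h) = op_mul f g + op_mul f h.
Proof. by apply: linopP => u /=; rewrite linopD. Qed.
Fact op_mulZl c f g : op_mul (c *: f) g = c *: op_mul f g.
Proof. exact: linopP. Qed.
Fact op_mulZr c f g : op_mul f (c *: g) = c *: op_mul f g.
Proof. by apply: linopP => u /=; rewrite linopZ. Qed.

HB.instance Definition _ := Lmodule_isNonUnitalAlgebra.Build K op
  op_mulA op_mulDl op_mulDr op_mulZl op_mulZr.

Lemma linop_sum I (r : seq I) (F : I -> op) u :
  (\sum_(i <- r) F i : op) u = \sum_(i <- r) F i u.
Proof. exact: (big_morph (fun f : op => f u) (fun _ _ => erefl) erefl). Qed.

Lemma linop_scaleE c (f : op) u : (c *: f) u = io c *: f u.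
Proof. by []. Qed.

Lemma linop_mulE (f g : op) u : amul f g u = f (g u).
Proof. by []. Qed.

End LinearOperators.

(** * A representation on functions of infinite paths *)

Section Representation.
Variables (k : nat) (L : kgraph k) (K : fieldType) (w : 'I_k -> nat).
Hypothesis rfns : row_finite_no_sources L.
Implicit Types (l m : kpath L) (x y : infinite_path L).
Local Notation E := {fraction {poly K}}.
Local Notation V := (infinite_path L -> E^o).
Local Notation io := (@tofrac {poly K} \o @polyC K).
Local Notation op := (linop V io).
Local Notation wt l := (weight w (kdeg l)).

Definition ratvar : E := tofrac 'X.

Lemma ratvarX_neq0 n : ratvar ^+ n != 0.
Proof. by rewrite expf_neq0 // tofrac_eq0 polyX_eq0. Qed.

(** S_l moves the value of f at x to the infinite path l x, and T_l moves it back,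
up to the factor that records the degree of l. *)
Definition repS_fun l (f : V) : V := fun x =>
  if segment x (kdeg l) == l then ratvar ^+ wt l * f (shift (kdeg l) x) else 0.
Definition repT_fun l (f : V) : V := fun x =>
  if path_vertex x 0 == ksrc l then ratvar ^- wt l * f (concat l x) else 0.
Definition repP_fun v (f : V) : V := fun x =>
  if path_vertex x 0 == v then f x else 0.

Fact repS_linear l : linear (repS_fun l).
Proof.
move=> c f g; apply/funext => x; rewrite /repS_fun !fctE /=; case: ifP => _.
  by rewrite mulrDr; congr (_ + _); exact: mulrCA.
by rewrite scaler0 addr0.
Qed.
Fact repT_linear l : linear (repT_fun l).
Proof.
move=> c f g; apply/funext => x; rewrite /repT_fun !fctE /=; case: ifP => _.
  by rewrite mulrDr; congr (_ + _); exact: mulrCA.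
by rewrite scaler0 addr0.
Qed.
Fact repP_linear v : linear (repP_fun v).
Proof.
move=> c f g; apply/funext => x; rewrite /repP_fun !fctE /=; case: ifP => _ //.
by rewrite scaler0 addr0.
Qed.

Definition repS l : op := mk_linop io (repS_linear l).
Definition repT l : op := mk_linop io (repT_linear l).
Definition repP v : op := mk_linop io (repP_linear v).

Lemma shift_shift (m n : degree k) x : shift n (shift m x) = shift (m + n) x.
Proof.
apply: infinite_path_eq => p; have [h1 e1] := segment_shift (m + n) x p.
have [h2 e2] := segment_shift m x n.
have [h3 e3] := segment_shift m x (n + p).
have [h4 e4] := segment_shift n (shift m x) p.
rewrite addrA e1 e4 in e3.
have h5 : ksrc (segment x (m + n)) = krng (segment (shift n (shift m x)) p).
  by rewrite e2 ksrc_comp.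
have [|_ ->//] := kcomp_inj h1 h5 erefl.
by rewrite e3 e2 kcompA.
Qed.

Lemma shift0 x : shift 0 x = x.
Proof.
have := @shift_concat k L (kid L (path_vertex x 0)) x; rewrite kdeg_id ksrc_id => h.
rewrite -{1}(h erefl) shift_shift addr0 h //.
Qed.

Lemma segment_comp l m x : ksrc l = krng m ->
  (segment x (kdeg (kcomp l m)) == kcomp l m) =
  (segment x (kdeg l) == l) && (segment (shift (kdeg l) x) (kdeg m) == m).
Proof.
move=> lm; rewrite kdeg_comp //.
have [h ->] := segment_shift (kdeg l) x (kdeg m).
apply/eqP/andP => [e|[/eqP e1 /eqP e2]]; last by rewrite e1 e2.
by have [|-> ->] := kcomp_inj h lm _ e; rewrite ?kdeg_segment.
Qed.

Lemma repS_comp l m : ksrc l = krng m ->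
  amul (repS l) (repS m) = repS (kcomp l m).
Proof.
move=> lm; apply: linopP => f; apply/funext => x /=.
rewrite /repS_fun segment_comp //; case: eqP => //= _; case: eqP => _; rewrite ?mulr0 //.
by rewrite mulrA -exprD -weightD shift_shift kdeg_comp.
Qed.

Lemma repT_comp l m : ksrc l = krng m ->
  amul (repT m) (repT l) = repT (kcomp l m).
Proof.
move=> lm; apply: linopP => f; apply/funext => x /=.
rewrite /repT_fun ksrc_comp //; case: eqP => // xm.
rewrite path_vertex_concat // lm eqxx concat_comp // mulrA -invfM -exprD.
by rewrite addnC -weightD kdeg_comp // addrC.
Qed.

Lemma segment_rng l x : segment x (kdeg l) = l -> path_vertex x 0 = krng l.
Proof. by move=> <-; rewrite krng_segment. Qed.

Definition rep : kp_family L op.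
Proof.
refine (@KPFamily K k L op repP (repS \o val) (repT \o val) _ _ _ _ _ _ _ _ _).
- move=> u v; apply: linopP => f; apply/funext => x /=; rewrite /repP_fun.
  have [->|uv] := eqVneq u v; first by rewrite /= /repP_fun; case: (_ == v).
  by case: eqP => // ->; rewrite (negPf uv).
- by move=> l m lm h e /=; rewrite repS_comp // e.
- by move=> l m lm h e /=; rewrite repT_comp // e.
- move=> l; apply: linopP => f; apply/funext => x /=; rewrite /repP_fun /repS_fun.
  have [/segment_rng ->|_] := eqVneq (segment x _) (val l); first by rewrite eqxx.
  by case: ifP.
- move=> l; apply: linopP => f; apply/funext => x /=; rewrite /repP_fun /repS_fun.
  by case: eqP => // /path_vertex_shift_deg ->; rewrite eqxx.
- move=> l; apply: linopP => f; apply/funext => x /=; rewrite /repP_fun /repT_fun.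
  by case: eqP.
- move=> l; apply: linopP => f; apply/funext => x /=; rewrite /repP_fun /repT_fun.
  by case: eqP => // xl; rewrite path_vertex_concat // eqxx.
- move=> l m lm; apply: linopP => f; apply/funext => x /=; rewrite /repT_fun /repS_fun.
  rewrite -lm -val_eqE; case: eqP => xl; last first.
    case: ifP => // _; rewrite /= /repP_fun; case: eqP => // e.
  rewrite segment_concat_deg // shift_concat //; case: eqP => [e|_]; last by rewrite mulr0.
  by rewrite mulrA mulVf ?ratvarX_neq0 // mul1r /= /repP_fun xl eqxx.
- move=> v n n0; apply: linopP => f; apply/funext => x.
  rewrite (npath_sum rfns (G := fun l => amul (repS l) (repT l))) // linop_sum.
  rewrite fct_sumE /= /repP_fun.
  have term l : l \in paths rfns v n -> amul (repS l) (repT l) f x =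
      if segment x n == l then f x else 0.
    move=> /mem_paths[lv ln] /=; rewrite /repS_fun /repT_fun -ln.
    case: eqP => // e; rewrite path_vertex_shift_deg // eqxx mulrA mulfV ?ratvarX_neq0 //.
    by rewrite mul1r concat_shift.
  rewrite big_seq (eq_bigr _ term) -big_seq -big_mkcond /=.
  rewrite -big_filter; under eq_filter do rewrite eq_sym.
  case: eqP => [xv|xv].
    rewrite filter_pred1_uniq ?paths_uniq ?big_seq1 //.
    by apply/mem_paths; rewrite krng_segment kdeg_segment.
  rewrite (_ : filter _ _ = [::]) ?big_nil //; apply/eqP; rewrite -[_ == _]negbK -has_filter.
  apply/negP => /hasP[l /mem_paths[lv ln] /eqP e]; apply: xv.
  by rewrite -lv e krng_segment.
Defined.

(** The universal property, extended to paths of degree zero. *)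
Lemma representation : exists h : {linear KP K L -> op},
  [/\ {morph h : a b / amul a b}, forall l, h (kpS K l) = repS l
    & forall l, h (kpT K l) = repT l].
Proof.
have [h [hM hp hs ht]] := kp_lift rep; exists h; split=> // l.
  have [/eqP/kdeg0_id ->|l0] := boolP (kdeg l == 0).
    rewrite kpS_id hp; apply: linopP => f; apply/funext => x /=.
    rewrite /repP_fun /repS_fun kdeg_id weight0 mul1r shift0 segment0.
    by rewrite (inj_eq (can_inj (@krng_id k L))).
  by rewrite -[l]/(val (Sub l l0 : npath L)) kpS_np hs.
have [/eqP/kdeg0_id ->|l0] := boolP (kdeg l == 0).
  rewrite kpT_id hp; apply: linopP => f; apply/funext => x /=.
  rewrite /repP_fun /repT_fun kdeg_id weight0 expr0 invr1 mul1r ksrc_id.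
  case: eqP => // e; congr f; rewrite -[LHS]shift0.
  by have := @concat_shift k L (kid L (krng l)) x; rewrite kdeg_id !shift0 segment0 e; move->.
by rewrite -[l]/(val (Sub l l0 : npath L)) kpT_np ht.
Qed.

End Representation.

(** * Linear independence of paths and minimal left ideals *)

Section Independence.
Variables (k : nat) (L : kgraph k) (K : fieldType).
Hypothesis rfns : row_finite_no_sources L.
Implicit Types (l m : kpath L) (x y : infinite_path L) (s : seq (K * kpath L)).
Local Notation E := {fraction {poly K}}.
Local Notation A := (KP K L).
Local Notation V := (infinite_path L -> E^o).
Local Notation op := (linop V (@tofrac {poly K} \o @polyC K)).
Local Notation t := (ratvar K).

Lemma rep_comb w (h : {linear A -> op}) s (f : V) x :
  (forall l, h (kpS K l) = repS K w l) ->
  h (comb s) f x = \sum_(c <- s) tofrac c.1%:P * repS K w c.2 f x.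
Proof.
move=> hS; rewrite /comb linear_sum linop_sum fct_sumE.
by apply: eq_bigr => c _; rewrite linearZ hS linop_scaleE.
Qed.

Lemma uniq_map_inj (T U : eqType) (g : T -> U) (r : seq T) :
  uniq (map g r) -> {in r &, injective g}.
Proof.
elim: r => //= a r IH /andP[ga gu] c d; rewrite !inE.
case/predU1P=> [->|cr]; case/predU1P=> [->|dr] //; last exact: IH.
  by move=> e; rewrite e map_f in ga.
by move=> e; rewrite -e map_f in ga.
Qed.

(** Apply the combination to the constant function 1 and evaluate at c0 y, for c0
one of its paths: the paths that contribute are initial segments of c0 y, hence
have distinct degrees, and the value is a polynomial in t in which the term of c0
has not been cancelled. *)
Lemma comb_neq0 v s : reduced v s -> comb s != 0.
Proof.
move=> [s0 su /allP sc /allP sv].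
case: s s0 su sc sv => // c0 s' _; set s := c0 :: s' => su sc sv.
have c0s : c0 \in s by rewrite mem_head.
have [w wi] := injective_weight [seq kdeg c.2 | c <- s].
have [h [hM hS hT]] := representation K w rfns.
have [y yv] := infinite_path_from rfns v.
have yc0 : path_vertex y 0 = ksrc c0.2 by rewrite yv; apply/esym/eqP/sv.
pose x := concat c0.2 y; pose s1 := [seq c <- s | segment x (kdeg c.2) == c.2].
pose e (c : K * kpath L) := weight w (kdeg c.2).
have ei : {in s1 &, injective e}.
  move=> c d; rewrite !mem_filter => /andP[/eqP cx cs] /andP[/eqP dx ds] cd.
  apply: (uniq_map_inj su) => //; rewrite -cx -dx; congr (segment x _).
  by apply: wi; rewrite ?map_f // (map_f (fun c => kdeg c.2)).
have s1u : uniq s1 by rewrite filter_uniq // (map_uniq su).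
have c0s1 : c0 \in s1 by rewrite mem_filter /x segment_concat_deg ?eqxx.
apply: contraNneq (sc _ c0s) => hs.
have := rep_comb s (fun=> 1) x hS; rewrite hs linear0.
rewrite (eq_bigr (fun c : K * kpath L =>
    if segment x (kdeg c.2) == c.2 then tofrac (c.1 *: 'X^(e c)) else 0)); last first.
  move=> c _ /=; rewrite /repS_fun; case: ifP; rewrite ?mulr0 // => _.
  by rewrite mulr1 -mul_polyC tofracM tofracXn.
rewrite -big_mkcond -big_filter -rmorph_sum => /esym/eqP.
rewrite tofrac_eq0 => /eqP q0.
by have := coef_sum_Xn (fun c => c.1) s1u ei c0s1; rewrite q0 coef0 => <-.
Qed.

Lemma kp_p_neq0 (v : kvertex L) : kp_p K v != 0.
Proof.
have : reduced v [:: (1 : K, kid L v)].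
  by split; rewrite //= ?oner_neq0 ?ksrc_id ?eqxx.
by move/comb_neq0; rewrite /comb big_seq1 scale1r kpS_id.
Qed.

Definition laurent (f : V) := forall x, exists n p, f x * t ^+ n = tofrac p.

(** All elements of the algebra preserve the Laurent polynomials inside K(t),
because the generators only multiply by powers of t. *)
Lemma rep_laurent w (h : {linear A -> op}) (a : A) (f : V) :
  {morph h : a b / amul a b} -> (forall l, h (kpS K l) = repS K w l) ->
  (forall l, h (kpT K l) = repT K w l) ->
  laurent f -> laurent (h a f).
Proof.
move=> hM hS hT fl; move: a; apply: (KP_ind rfns) => [|a b ha hb|c a ha|l m _] x.
- by rewrite linear0; exists 0%N, 0; rewrite tofrac0 mul0r.
- have [n [p e]] := ha x; have [n' [p' e']] := hb x.
  rewrite linearD; exists (n + n')%N, (p * 'X^n' + p' * 'X^n).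
  rewrite tofracD !tofracM -e -e' !tofracXn mulrDl; congr (_ + _).
    by rewrite exprD mulrA.
  by rewrite addnC exprD mulrA.
- have [n [p e]] := ha x; rewrite linearZ linop_scaleE; exists n, (c *: p).
  by rewrite -mul_polyC tofracM -e; exact/esym/mulrA.
rewrite hM hS hT /= /repS_fun; case: eqP => _; last first.
  by exists 0%N, 0; rewrite tofrac0 mul0r.
rewrite /repT_fun; case: eqP => _; last first.
  by exists 0%N, 0; rewrite tofrac0 mulr0 mul0r.
set z := concat _ _; have [n [p e]] := fl z.
exists (n + weight w (kdeg m))%N, ('X^(weight w (kdeg l)) * p).
rewrite tofracM tofracXn -e exprD -!mulrA; congr (_ * _).
rewrite mulrCA; congr (_ * _); rewrite mulrCA mulVf ?mulr1 //.
exact: ratvarX_neq0.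
Qed.

Definition point y : V := fun x => `[< x = y >]%:R.

Lemma repS_point w l y : path_vertex y 0 = ksrc l ->
  repS K w l (point y) = t ^+ weight w (kdeg l) *: point (concat l y).
Proof.
move=> yl; apply/funext => x; rewrite /= /repS_fun fctE /point.
have -> : `[< x = concat l y >] =
    (segment x (kdeg l) == l) && `[< shift (kdeg l) x = y >].
  apply/asboolP/andP => [->|[/eqP xl /asboolP <-]]; last by rewrite concat_shift.
  by rewrite segment_concat_deg // shift_concat // eqxx asboolT.
by case: eqP => //= _; rewrite scaler0.
Qed.

Lemma repT_point w l y : path_vertex y 0 = ksrc l ->
  repT K w l (point (concat l y)) = t ^- weight w (kdeg l) *: point y.
Proof.
move=> yl; apply/funext => x; rewrite /= /repT_fun fctE /point.
have -> : `[< x = y >] =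
    (path_vertex x 0 == ksrc l) && `[< concat l x = concat l y >].
  apply/asboolP/andP => [->|[/eqP xl /asboolP e]]; first by rewrite yl eqxx asboolT.
  by rewrite -(shift_concat xl) e shift_concat.
by case: eqP => //= _; rewrite scaler0.
Qed.

(** The left multiples of a form a left ideal; it contains a itself because a has a
left unit. *)
Lemma minimal_generator (M : set A) (a b : A) : minimal_left_ideal M ->
  M a -> a != 0 -> M b -> exists u, b = amul u a.
Proof.
move=> [[[M0 MD MZ] Ml] _ Mmin] Ma a0 Mb.
have [|c [u _ <-]|I0|IM] := Mmin [set amul u a | u in setT].
- split; last by move=> u _ [u' _ <-]; exists (amul u u') => //; rewrite amulA.
  split; first by exists 0; rewrite ?amul0l.
    by move=> _ _ [u _ <-] [u' _ <-]; exists (u + u'); rewrite ?amulDl.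
  by move=> c _ [u _ <-]; exists (c *: u); rewrite ?amulZl.
- exact: Ml.
- have [u ua] := left_unit rfns a; case/eqP: a0.
  have : [set amul u a | u in setT] a by exists u.
  by rewrite I0.
- by move: Mb; rewrite -IM => -[u _ <-]; exists u.
Qed.

(** In the representation, T_(c0) comb s multiplies the function concentrated at y
by the scalar C = q(t) / t^n, where q has one term for each element of s: the
paths of s have the same effect on y but distinct degrees.  Minimality forces C to
be invertible among the Laurent polynomials. *)
Lemma minimal_comb_size (M : set A) (m z : A) s v y : minimal_left_ideal M ->
  M m -> amul m z = comb s -> reduced v s -> path_vertex y 0 = v ->
  {in s &, forall c d, concat c.2 y = concat d.2 y} -> (size s <= 1)%N.
Proof.
move=> Mmin Mm mz sr yv sy.
case: (sr) => s0 su /allP sc /allP sv.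
case: s s0 su sc sv mz sr sy => // c0 s' _; set s := c0 :: s' => su sc sv mz sr sy.
have c0s : c0 \in s by rewrite mem_head.
have yc c : c \in s -> path_vertex y 0 = ksrc c.2.
  by move=> /sv/eqP ->.
have [w wi] := injective_weight [seq kdeg c.2 | c <- s].
have [h [hM hS hT]] := representation K w rfns.
pose e (c : K * kpath L) := weight w (kdeg c.2).
have ei : {in s &, injective e}.
  move=> c d cs ds cd; apply: (uniq_map_inj su) => //.
  rewrite -(segment_concat_deg (yc c cs)) -(segment_concat_deg (yc d ds)).
  rewrite (sy c d) //; congr (segment _ _).
  by apply: wi; rewrite // (map_f (fun c => kdeg c.2)).
(* The negative exponents that T_(c0) contributes are put in the denominator of C. *)
pose q := \sum_(c <- s) c.1 *: 'X^(e c).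
have qc c : c \in s -> q`_(e c) = c.1.
  by move=> cs; apply: (coef_sum_Xn (fun c => c.1)) => //; exact: map_uniq su.
have q0 : q != 0.
  by apply: contraNneq (sc _ c0s) => q0; rewrite -(qc c0) // q0 coef0.
pose C : E := tofrac q / t ^+ e c0.
have C0 : C != 0 by rewrite mulf_neq0 ?invr_eq0 ?ratvarX_neq0 ?tofrac_eq0.
pose a := amul (kpT K c0.2) (comb s).
have ha : h a (point y) = C *: point y.
  have hc : h (comb s) (point y) = tofrac q *: point (concat c0.2 y).
    apply/funext => x; rewrite (rep_comb _ _ _ hS) rmorph_sum scaler_suml fct_sumE.
    rewrite big_seq [RHS]big_seq; apply: eq_bigr => c cs.
    rewrite repS_point ?(yc c) // (sy c c0) //.
    by rewrite -mul_polyC rmorphM rmorphXn !fctE; exact: mulrA.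
  by rewrite hM linop_mulE hc linopZ hT repT_point ?(yc c0) // scalerA.
pose m1 := amul (kpT K c0.2) m.
have m1z : amul m1 z = a by rewrite /m1 -amulA mz.
have Mm1 : M m1 by case: Mmin => -[_ Ml] _ _; exact: Ml.
have Mm2 : M (amul a m1) by case: Mmin => -[_ Ml] _ _; exact: Ml.
have haa : h (amul a a) (point y) = (C * C) *: point y.
  by rewrite hM linop_mulE ha linopZ ha scalerA.
have scaley c : (c *: point y : V) y = c.
  by rewrite fctE /point asboolT //; exact: mulr1.
have m20 : amul a m1 != 0.
  apply: contraNneq C0 => m20.
  have : amul (amul a m1) z = 0 by rewrite m20 amul0l.
  rewrite -amulA m1z => aa0; have : C * C = 0 by rewrite -[LHS]scaley -haa aa0 linear0.
  by move/eqP; rewrite mulf_eq0 orbb.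
have [x xm] := minimal_generator Mmin Mm2 m20 Mm1.
(* M is generated by a m1, so m1 = x a m1; multiply by z. *)
have ax : a = amul x (amul a a).
  by rewrite -[LHS]m1z [X in amul X z]xm -(amulA x) -(amulA a) m1z.
have [|n [p Xp]] := @rep_laurent w h x (point y) hM hS hT _ y.
  by move=> z'; exists 0%N, (`[< z' = y >]%:R); rewrite mulr1 /point rmorph_nat.
have CX : C * h x (point y) y = 1.
  apply: (mulfI C0); rewrite mulr1 mulrA.
  rewrite -[RHS]scaley -ha [in RHS]ax hM linop_mulE haa linopZ.
  by rewrite fctE.
have qp : q * p = 'X^(e c0 + n).
  apply/eqP; rewrite -tofrac_eq tofracM -Xp tofracXn exprD; apply/eqP.
  rewrite mulrA; congr (_ * _).
  by rewrite -[RHS]mul1r -CX mulrAC divfK ?ratvarX_neq0.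
have qd : q %| 'X^(e c0 + n) by rewrite -qp dvdp_mulr.
rewrite leqNgt; apply/negP => s2.
have c1s : nth c0 s 1 \in s by rewrite mem_nth.
have c01 : c0 = nth c0 s 1.
  by apply: ei => //; apply: (dvd_Xn_coef qd); rewrite qc // sc.
have := nth_uniq c0 (isT : 0 < size s)%N s2 (map_uniq su).
by rewrite -c01 /= eqxx.
Qed.

End Independence.

(** * The socle and the ideal of line points *)

Section Socle.
Variables (k : nat) (L : kgraph k) (K : fieldType).
Hypothesis rfns : row_finite_no_sources L.
Implicit Types (l m : kpath L) (v w : kvertex L) (x y : infinite_path L).
Implicit Types (s : seq (K * kpath L)).
Local Notation A := (KP K L).

Lemma kpS_neq0 l : kpS K l != 0.
Proof.
apply: contraNneq (kp_p_neq0 K rfns (ksrc l)) => l0.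
by have := mul_TS K rfns (erefl (kdeg l)); rewrite eqxx l0 amul0r => <-.
Qed.

(** Multiplying by S_g T_g on the left keeps the paths that start with g, once they
are long enough to be compared with g; the right factor makes them so. *)
Lemma cut_comb v s (y : infinite_path L) b n : path_vertex y 0 = v -> ksrc b = v ->
  all (fun c => ksrc c.2 == v) s ->
  let g := segment (concat b y) (kdeg b + n) in
  let t := segment y (kdeg b + n) in
  amul (kpS K g) (amul (kpT K g) (amul (comb s) (kpS K t))) =
  comb (extend_by t [seq c <- s | segment (concat c.2 y) (kdeg b + n) == g]).
Proof.
move=> yv bv sv g t; rewrite comb_mulS //; last by rewrite krng_segment yv.
rewrite /comb /extend_by !big_map big_filter !amul_sumr [RHS]big_mkcond.
rewrite big_seq [RHS]big_seq; apply: eq_bigr => c /(allP sv)/eqP cv /=.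
have yc : path_vertex y 0 = ksrc c.2 by rewrite yv.
have ct : kcomp c.2 t = segment (concat c.2 y) (kdeg c.2 + (kdeg b + n)).
  by rewrite segment_concat.
have gd : kdeg g = kdeg b + n by rewrite kdeg_segment.
have le : dle (kdeg b + n) (kdeg c.2 + (kdeg b + n)) by rewrite [X in dle _ X]addrC dle_addr.
have leg : dle (kdeg g) (kdeg (kcomp c.2 t)) by rewrite ct gd kdeg_segment.
rewrite !amulZr mul_TS_suf // gd ct kpre_segment //.
case: eqP => [e|_]; last by rewrite amul0r scaler0.
have [h d e'] := kpresufP leg.
rewrite gd ct kpre_segment // e in h d e'.
by rewrite mul_SS // -e'.
Qed.

(** In a combination with the least possible number of terms, no cut as in
[cut_comb] removes a term, so all its paths agree when continued by y. *)
Lemma minimal_has_vertex (M : set A) : minimal_left_ideal M ->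
  exists a z v, M a /\ amul a z = kp_p K v.
Proof.
move=> Mmin; have [[[M0 MD MZ] Mm] MN _] := Mmin.
pose P n := exists a z v s, [/\ M a, amul a z = comb s, reduced v s & size s = n].
have exP : exists n, `[< P n >].
  have [a Ma a0] : exists2 a, M a & a != 0.
    apply: contrapT => h; apply: MN; apply/seteqP; split=> [a Ma|_ ->//].
    by apply: contrapT => /eqP a0; apply: h; exists a.
  have [l [s [sr e _]]] := reduction rfns a0.
  by exists (size s); apply/asboolP; exists a, (kpS K l), (ksrc l), s.
case: (ex_minnP exP) => n /asboolP[a [z [v [s [Ma az sr sn]]]]] nmin.
have [y yv] := infinite_path_from rfns v.
have [s0 su sc sv] := sr.
have agree b c : b \in s -> c \in s -> concat c.2 y = concat b.2 y.
  move=> bs cs; have /eqP bv := allP sv b bs.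
  apply: (@infinite_path_eq_cofinal k L _ _ (kdeg b.2)) => p; apply/eqP.
  pose f (d : K * kpath L) := segment (concat d.2 y) (kdeg b.2 + p) ==
    segment (concat b.2 y) (kdeg b.2 + p).
  suff /allP/(_ c cs) : all f s by [].
  rewrite all_count eqn_leq count_size -size_filter sn; apply: nmin; apply/asboolP.
  have ce := cut_comb p yv bv sv.
  set g := segment (concat b.2 y) _ in ce; set t := segment y _ in ce.
  (* The cut combination has as many terms as s satisfy f, and at least b. *)
  exists (amul (kpS K g) (amul (kpT K g) a)), (amul z (kpS K t)), (ksrc t).
  exists (extend_by t (filter f s)).
  split; [by do 2!apply: (Mm)| |apply: reduced_extend|by rewrite size_map].
    by rewrite -!amulA (amulA a) az.
  have tv : krng t = v by rewrite krng_segment.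
  rewrite tv; split.
  - by rewrite -has_filter; apply/hasP; exists b; rewrite // /f eqxx.
  - exact: (subseq_uniq (map_subseq _ (filter_subseq _ _)) su).
  - by apply/allP => d; rewrite mem_filter => /andP[_ /(allP sc)].
  - by apply/allP => d; rewrite mem_filter => /andP[_ /(allP sv)].
have := minimal_comb_size rfns Mmin Ma az sr yv (fun b c bs cs => agree c b cs bs).
case: s s0 {su agree sr sn} sc sv az => // c [|//] _ /=; rewrite !andbT => c0 /eqP cv az _.
exists (c.1^-1 *: amul (kpT K c.2) a), z, v; split; first by apply: MZ; apply: Mm.
rewrite amulZl -amulA az /comb big_seq1 amulZr mul_TS // eqxx scalerA mulVf //.
by rewrite scale1r cv.
Qed.

(** Were l and m distinct of the same degree, M would be generated by S_l T_l a, and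
p_v would be a left multiple of S_l T_l, which is killed by S_m on the right.  Were
they of the same source, they would be continued alike by all infinite paths, and
S_l + S_m would contradict [minimal_comb_size]. *)
Lemma minimal_vertex_line_point (M : set A) (a z : A) v : minimal_left_ideal M ->
  M a -> amul a z = kp_p K v -> line_points L v.
Proof.
move=> Mmin Ma az; apply/(line_pointsP rfns).
have one l m : krng l = v -> krng m = v -> kdeg l = kdeg m -> l = m.
  move=> lv mv lm; apply: contrapT => /eqP ne.
  pose b := amul (kpS K l) (amul (kpT K l) a).
  have Mb : M b by case: (Mmin) => -[_ Mm] _ _; do 2!apply: (Mm).
  have bz : amul b z = amul (kpS K l) (kpT K l).
    by rewrite -!amulA az -lv mul_Tp.
  have b0 : b != 0.
    apply: contraNneq (kpS_neq0 l) => b0; have := congr1 (amul^~ (kpS K l)) bz.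
    by rewrite b0 !amul0l -amulA mul_TS // eqxx mul_Sp // => <-.
  have [u ub] := minimal_generator rfns Mmin Mb b0 Ma.
  case/eqP: (kpS_neq0 m); rewrite -(mul_pS K rfns) mv -az ub -(amulA u) bz.
  by rewrite -!amulA mul_TS // (negPf ne) !amul0r.
split=> // l m lv mv lm; apply: contrapT => /eqP ne.
have [y yl] := infinite_path_from rfns (ksrc l).
have ylm : concat l y = concat m y.
  apply: infinite_path_eq => n; apply: one; rewrite ?kdeg_segment // krng_segment.
    by rewrite path_vertex_concat.
  by rewrite path_vertex_concat -?lm.
pose s : seq (K * kpath L) := [:: (1, l); (1, m)].
have sr : reduced (ksrc l) s.
  by split=> //=; rewrite ?inE ?ne ?oner_neq0 ?lm ?eqxx.
have := @minimal_comb_size _ _ _ rfns M a (amul z (comb s)) s _ y Mmin Ma _ sr yl.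
rewrite amulA az => h; suff : (size s <= 1)%N by [].
apply: h.
  rewrite /s /comb !big_cons big_nil addr0 !scale1r amulDr.
  by rewrite -{1}lv -mv !mul_pS.
by move=> c d; rewrite !inE => /orP[/eqP->|/eqP->] /orP[/eqP->|/eqP->] /=.
Qed.

Lemma vertex_idealP (H : set (kvertex L)) : two_sided_ideal (vertex_ideal K H).
Proof. exact: ideal_gen_ideal. Qed.

Lemma vertex_ideal_p (H : set (kvertex L)) v : H v -> vertex_ideal K H (kp_p K v).
Proof. by move=> Hv; apply: sub_ideal_gen; exists v. Qed.

(** With p_v = a z and a in M, the element p_v a lies in both M and the ideal, and
generates M. *)
Lemma socle_sub_line_ideal : socle A `<=` vertex_ideal K (line_points L).
Proof.
have [[Jsub Jl] Jr] := vertex_idealP (line_points L).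
apply: socle_sub => // M Mmin.
have [a [z [v [Ma az]]]] := minimal_has_vertex Mmin.
have vl := minimal_vertex_line_point Mmin Ma az.
have pa : amul (kp_p K v) a != 0.
  apply: contraNneq (kp_p_neq0 K rfns v) => pa.
  have := congr1 (amul (kp_p K v)) az.
  by rewrite amulA pa amul0l mul_pp // eqxx => <-.
have Mpa : M (amul (kp_p K v) a) by case: (Mmin) => -[_ Mm] _ _; apply: Mm.
move=> b /(minimal_generator rfns Mmin Mpa pa)[u ->].
by apply: Jl; apply: Jr; exact: vertex_ideal_p.
Qed.

(** Expand S_m as the sum of the S_(m t) T_t with t of the degree of l.  If m t
starts with l, the rest is a path from the line point with the same source as t,
hence equals t, and m t = l t forces l = m. *)
Lemma line_point_TS l m : line_points L (ksrc l) -> ksrc m = ksrc l -> l != m ->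
  amul (kpT K l) (kpS K m) = 0.
Proof.
move=> /(line_pointsP rfns)[_ inj] ml lm.
rewrite (S_sum K rfns m (kdeg l)) amul_sumr big_seq big1 // => t /mem_paths[tm td].
have le : dle (kdeg l) (kdeg (kcomp m t)).
  by rewrite kdeg_comp // td addrC dle_addr.
rewrite amulA mul_TS_suf //; case: eqP => [e|_]; last by rewrite amul0l.
have [h d e'] := kpresufP le; rewrite e in h e'.
have r : ksuf (kdeg l) (kcomp m t) = t.
  by apply: inj; rewrite ?tm // ksrc_suf // ksrc_comp.
case/eqP: lm; apply: (@kcompIr _ _ t); rewrite ?tm //.
by rewrite [RHS]e' r.
Qed.

(** A nonzero a in A p_v is brought to a nonzero multiple of a vertex projection by
[reduction] and [line_point_TS]; since l is the only path of its degree from v,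
S_l T_l = p_v, which carries this back to p_v. *)
Lemma line_point_minimal v : line_points L v ->
  minimal_left_ideal [set a : A | amul a (kp_p K v) = a].
Proof.
move=> vl; split.
- split; last by move=> a x /= e; rewrite -amulA e.
  split=> [|x y /= ex ey|c x /= ex]; rewrite /= ?amul0l //.
    by rewrite amulDl ex ey.
  by rewrite amulZl ex.
- move=> e; case/eqP: (kp_p_neq0 K rfns v).
  have : [set a : A | amul a (kp_p K v) = a] (kp_p K v) by rewrite /= mul_pp // eqxx.
  by rewrite e.
move=> I [[I0 ID IZ] Im] Isub.
have [h|nI] := pselect (forall a, I a -> a = 0).
  by left; apply/seteqP; split=> // _ ->.
have [a Ia a0] : exists2 a, I a & a != 0.
  by apply: contrapT => h; apply: nI => a Ia; apply: contrapT => /eqP ?; apply: h; exists a.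
right; apply/seteqP; split=> // b /= <-; apply: (Im).
have [l [s [[s0 su sc sv] e cs0]]] := reduction rfns a0.
have apv := Isub a Ia; rewrite /= in apv.
have lv : krng l = v.
  apply: contrapT => /eqP lv; case/eqP: cs0.
  rewrite -e -apv -(mul_pS K rfns l) -amulA (amulA (kp_p K v)) mul_pp //.
  by rewrite eq_sym (negPf lv) amul0l amul0r.
have ll : line_points L (ksrc l).
  by apply: (line_points_hereditary rfns); rewrite lv.
case: s s0 su sc sv e {cs0} => // c s _ /= /andP[cs su] /andP[c0 sc] /andP[/eqP cl sv] e.
have Te : amul (kpT K c.2) (amul a (kpS K l)) = c.1 *: kp_p K (ksrc l).
  rewrite e /comb big_cons amulDr amulZr mul_TS // eqxx cl amul_sumr big_seq big1 ?addr0 //.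
  move=> d ds; rewrite amulZr line_point_TS ?scaler0 ?cl //.
    exact/eqP/(allP sv).
  by apply: contraNneq cs => ->; exact: map_f.
have pe : amul (kpS K l) (kpT K l) = kp_p K v.
  rewrite (p_sum K rfns v (kdeg l)).
  have -> : paths rfns v (kdeg l) = [:: l].
    have [one _] := (line_pointsP rfns v).1 vl.
    apply/perm_small_eq => //; apply: uniq_perm => [||m]; [exact: paths_uniq|by []|].
    rewrite mem_seq1; apply/idP/eqP => [/mem_paths[mv md]|->]; first exact: one.
    exact/mem_paths.
  by rewrite big_seq1.
have -> : kp_p K v = c.1^-1 *: amul (kpS K l) (amul (kpT K c.2) a).
  rewrite -[in RHS]apv -{2}pe !amulA -(amulA (kpS K l)) -(amulA (kpS K l) (amul _ _)).
  rewrite -(amulA (kpT K c.2)) Te amulZr amulZl scalerA mulVf // scale1r.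
  by rewrite mul_Sp.
by apply: IZ; do 2!apply: (Im).
Qed.

Lemma line_ideal_sub_socle : vertex_ideal K (line_points L) `<=` socle A.
Proof.
apply: ideal_gen_sub; first exact: socle_ideal.
move=> _ [v vl <-]; exists [:: kp_p K v]; rewrite big_seq1; split=> // x.
rewrite mem_seq1 => /eqP ->.
exists [set a : A | amul a (kp_p K v) = a]; split; first exact: line_point_minimal.
by rewrite /= mul_pp // eqxx.
Qed.

Lemma socle_eq : socle A = vertex_ideal K (line_points L).
Proof.
apply/seteqP; split; [exact: socle_sub_line_ideal|exact: line_ideal_sub_socle].
Qed.

Lemma vertex_ideal_closure (W : set (kvertex L)) :
  vertex_ideal K W = vertex_ideal K (sat_her_closure W).
Proof.
apply/seteqP; split; apply: ideal_gen_sub; try exact: vertex_idealP.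
  move=> _ [v Wv <-]; by apply: vertex_ideal_p; apply: sub_smallest Wv.
have [[[J0 JD JZ] Jl] Jr] := vertex_idealP W.
suff h : sat_her_closure W `<=` [set v | vertex_ideal K W (kp_p K v)].
  by move=> _ [v /h ? <-].
apply: smallest_sub; last by move=> v Wv; exact: vertex_ideal_p.
split=> [v n h|l] /=.
  rewrite (p_sum K rfns v n); apply: subspace_sum => // l /mem_paths[lv ln] _.
  rewrite -(mul_Sp K rfns l) -amulA; apply: Jl; apply: Jr; apply: h.
  by exists l.
move=> h; rewrite -(_ : amul (kpT K l) (kpS K l) = kp_p K (ksrc l)); last first.
  by rewrite mul_TS // eqxx.
by rewrite -(mul_pS K rfns l) amulA; apply: Jr; apply: Jl.
Qed.

Lemma line_ideal_annihilator (a : A) :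
  (forall w, exists l, krng l = w /\ line_points L (ksrc l)) ->
  (forall j, vertex_ideal K (line_points L) j -> amul a j = 0) -> a = 0.
Proof.
move=> conn ann; apply: contrapT => /eqP a0.
have [l [s [sr e _]]] := reduction rfns a0.
have [m [ml mp]] := conn (ksrc l).
have [[_ Jl] Jr] := vertex_idealP (line_points L).
have := ann (amul (kpS K l) (kpS K m)).
have sm : all (fun c => ksrc c.2 == krng m) s by rewrite ml; case: sr.
rewrite amulA e comb_mulS //.
move=> h; have er : reduced (ksrc m) (extend_by m s).
  by apply: reduced_extend; rewrite ml.
have /eqP := comb_neq0 rfns er; apply; apply: h.
rewrite -(mul_Sp K rfns m) amulA; apply: Jl.
exact: vertex_ideal_p.
Qed.

(** If p_w S_l T_m p_v is nonzero and v is a line point, then l leads from w to the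
source of m, which is again a line point.  The set I below is the largest ideal
annihilated by p_w on the left. *)
Lemma vertex_annihilates_line_ideal w :
  (forall l, krng l = w -> ~ line_points L (ksrc l)) ->
  forall j, vertex_ideal K (line_points L) j -> amul (kp_p K w) j = 0.
Proof.
move=> nc.
pose I : set A := [set j | amul (kp_p K w) j = 0 /\
  forall a, amul (amul (kp_p K w) a) j = 0].
suff : vertex_ideal K (line_points L) `<=` I by move=> h j /h[].
apply: ideal_gen_sub.
  split; first split; first split.
  - by split=> [|x]; rewrite amul0r.
  - by move=> x y [x0 xz] [y0 yz]; split=> [|z]; rewrite amulDr ?x0 ?y0 ?xz ?yz addr0.
  - by move=> c x [x0 xz]; split=> [|z]; rewrite amulZr ?x0 ?xz scaler0.
  - by move=> a x [x0 xz]; split=> [|z]; rewrite amulA ?xz // -(amulA _ z) xz.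
  - by move=> a x [x0 xz]; split=> [|z]; rewrite amulA ?x0 ?xz amul0l.
move=> _ [v vl <-]; have wxv (x : A) : amul (amul (kp_p K w) x) (kp_p K v) = 0.
  move: x; apply: (KP_ind rfns) => [|x y ex ey|c x ex|l m lm].
  - by rewrite amul0r amul0l.
  - by rewrite amulDr amulDl ex ey addr0.
  - by rewrite amulZr amulZl ex scaler0.
  have [lw|lw] := eqVneq (krng l) w; last first.
    by rewrite -(mul_pS K rfns l) !amulA mul_pp // eq_sym (negPf lw) !amul0l.
  have [mv|mv] := eqVneq (krng m) v; last first.
    by rewrite -(mul_Tp K rfns m) -!amulA mul_pp // (negPf mv) !amul0r.
  by case: (nc l lw); rewrite lm; apply: (line_points_hereditary rfns); rewrite mv.
split=> //=; have := wxv (kp_p K w); rewrite mul_pp // eqxx //.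
Qed.

End Socle.

Theorem theorem3p10 (k : nat) (k_gt0 : (0 < k)%N) (L : kgraph k)
    (L_rfns : row_finite_no_sources L) (K : fieldType) :
  (socle (KP K L) = vertex_ideal K (line_points L) /\
   vertex_ideal K (line_points L) =
     vertex_ideal K (sat_her_closure (line_points L))) /\
  (essential_ideal (socle (KP K L)) <->
     forall w : kvertex L, exists l : kpath L,
       krng l = w /\ line_points L (ksrc l)).
Proof.
split; first by split; [exact: socle_eq|exact: vertex_ideal_closure].
rewrite socle_eq //; have J := vertex_idealP K (line_points L).
have [[[J0 _ _] _] _] := J.
split=> [[_ ess] w|conn].
  apply: contrapT => nc; case/eqP: (kp_p_neq0 K L_rfns w); apply: ess.
  apply/seteqP; split=> [_ [j Jj <-]|_ ->]; last by exists 0; rewrite ?amul0r.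
  apply: vertex_annihilates_line_ideal Jj => // l lw ll; apply: nc.
  by exists l.
split=> // a aJ; apply: (line_ideal_annihilator L_rfns conn) => j Jj.
have : [set amul a x | x in vertex_ideal K (line_points L)] (amul a j) by exists j.
by rewrite aJ.
Qed.
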